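(* Let $R$ be a commutative Noetherian local ring, and let $M$ and $N$ be non-zero finitely generated $R$-modules such that $\operatorname{qpd}_R N<\infty$ and $\operatorname{q}^R(M,N)=0$. Then, for any finitely generated $R$-module $L$, we have: (1) $\operatorname{grade}(L,M)\leq\operatorname{grade}(L,M\otimes_R N)+\operatorname{qpd}_R N$. (2) If $\operatorname{Supp} L\subseteq\operatorname{Supp} N$, then $\operatorname{grade}(L,M\otimes_R N)+\operatorname{grade} N\leq\operatorname{grade}(L,M)$. In particular, if $\operatorname{Supp} L\subseteq\operatorname{Supp} N$ and $N$ is quasi-perfect, then equality holds in both (1) and (2).
   Context: For finitely generated $R$-modules, $\operatorname{grade}(M,N):=\inf\{i\ge 0:\operatorname{Ext}^i_R(M,N)\ne 0\}$ (with $\inf\emptyset=\infty$), $\operatorname{grade} M:=\operatorname{grade}(M,R)$, and $\operatorname{q}^R(M,N):=\sup\{i\ge 0:\operatorname{Tor}^R_i(M,N)\neq 0\}$ (with $\sup\emptyset=-\infty$). For a complex $X$ of $R$-modules (homologically indexed), $\sup X=\sup\{i: X_i\ne 0\}$, $\inf X=\inf\{i: X_i\neq 0\}$, $\operatorname{hsup}X=\sup\{i: H_i(X)\neq 0\}$. $X$ is bounded below if $\inf X>-\infty$, and bounded if $\sup X-\inf X<\infty$. A quasi-projective resolution of $M$ is a bounded below complex $P$ of (finitely generated) projective $R$-modules such that for all $i\ge\inf P$ there exist non-negative integers $a_i$, not all zero, with $H_i(P)\cong M^{\oplus a_i}$. The quasi-projective dimension of $M\neq 0$ is $\operatorname{qpd}_R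 M=\inf\{\sup P-\operatorname{hsup}P : P \text{ is a bounded quasi-projective resolution of } M\}$; it is $\infty$ if $M$ has no bounded quasi-projective resolution. $M$ is called quasi-perfect if $\operatorname{qpd}_R M<\infty$ and $\operatorname{qpd}_R M=\operatorname{grade} M$. *)

(* Defs.v *)
From HB Require Import structures.
From mathcomp Require Import all_boot all_order all_algebra.
From mathcomp Require Import generic_quotient ring_quotient.
From mathcomp Require Import finmap.
From mathcomp Require Import boolp classical_sets functions.
From mathcomp Require Import constructive_ereal.
From mathcomp Require Import ring.
(* The notations of monalg clash with those of classical_sets, so that the free
   R-module {malg R[X]} on X is written malg X R, and its basis vector at x is
   written mkmalgU x 1. *)
From mathcomp Require Import -(notations) monalg.

Set Implicit Arguments.
Unset Strict Implicit.
Unset Printing Implicit Defensive.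

Import Order.TTheory GRing.Theory Num.Theory.

Local Open Scope classical_set_scope.
Local Open Scope quotient_scope.
Local Open Scope ring_scope.

Section Modules.
Variable R : comNzRingType.
Implicit Types U V W : lmodType R.

Definition nonzero_module V : Prop := exists v : V, v != 0.

Definition fin_gen V : Prop :=
  exists n (g : 'I_n -> V), forall v, exists c : 'I_n -> R,
    v = \sum_i c i *: g i.

Definition projective (P : lmodType R) : Prop :=
  forall (V W : lmodType R) (p : {linear V -> W}) (f : {linear P -> W}),
    (forall w, exists v, p v = w) ->
    exists g : {linear P -> V}, forall x, p (g x) = f x.

Definition isomorphic U V : Prop :=
  exists f : {linear U -> V}, bijective f.

Definition submod V (S : submodClosed V) := {x : V | x \in S}.
HB.instance Definition _ V (S : submodClosed V) := SubChoice.on (submod S).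
HB.instance Definition _ V (S : submodClosed V) :=
  [SubChoice_isSubLmodule of submod S by <:].

Section QuotientModule.
Variables (V : lmodType R) (S : submodClosed V).

Definition quot_pred : {pred V} := S.
Fact submod_zmod_closed : zmod_closed quot_pred.
Proof.
by split=> [|x y Sx Sy]; rewrite ?rpred0// -scaleN1r rpredD ?rpredZ.
Qed.
HB.instance Definition _ := GRing.isZmodClosed.Build V quot_pred submod_zmod_closed.

Definition quotmod := Quotient.quot quot_pred.
HB.instance Definition _ := GRing.Zmodule.on quotmod.
HB.instance Definition _ := @EqQuotient.on quotmod.

Definition qpi (v : V) : quotmod := \pi_(Quotient.quot quot_pred) v.

Lemma qpiP x y : reflect (qpi x = qpi y) (x - y \in S).
Proof.
by rewrite -[x - y \in S]/(x - y \in quot_pred) Quotient.idealrBE; exact: eqP.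
Qed.

Lemma qpi_repr (x : quotmod) : qpi (repr x) = x.
Proof. by rewrite /qpi reprK. Qed.

Lemma qpiD x y : qpi (x + y) = qpi x + qpi y.
Proof. exact: Quotient.pi_add. Qed.

Definition quot_scale (a : R) (x : quotmod) : quotmod := qpi (a *: repr x).

Lemma qpiZ a x : qpi (a *: x) = quot_scale a (qpi x).
Proof.
by apply/qpiP; rewrite -scalerBr rpredZ//; apply/qpiP; rewrite qpi_repr.
Qed.

Fact quot_scaleA a b x : quot_scale a (quot_scale b x) = quot_scale (a * b) x.
Proof. by rewrite -[x]qpi_repr -!qpiZ scalerA. Qed.
Fact quot_scale1 : left_id 1 quot_scale.
Proof. by move=> x; rewrite -[x]qpi_repr -qpiZ scale1r. Qed.
Fact quot_scaleDr : right_distributive quot_scale +%R.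
Proof.
move=> a x y; rewrite -[x]qpi_repr -[y]qpi_repr.
by rewrite -qpiD -!qpiZ scalerDr qpiD.
Qed.
Fact quot_scaleDl x : {morph quot_scale^~ x : a b / a + b}.
Proof. by move=> a b; rewrite -[x]qpi_repr -!qpiZ scalerDl qpiD. Qed.

HB.instance Definition _ := GRing.Zmodule_isLmodule.Build R quotmod
  quot_scaleA quot_scale1 quot_scaleDr quot_scaleDl.

Fact qpi_is_linear : linear qpi.
Proof. by move=> a x y; rewrite qpiD qpiZ. Qed.
HB.instance Definition _ := GRing.isLinear.Build R V quotmod _ qpi qpi_is_linear.

End QuotientModule.

Section Kernel.
Variables (U V : lmodType R) (f : {linear U -> V}).

Definition ker_pred : {pred U} := fun x => f x == 0.

Fact ker_closed : submod_closed ker_pred.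
Proof.
split=> [|a x y]; rewrite !unfold_in ?linear0// => /eqP fx /eqP fy.
by rewrite linearP fx fy scaler0 addr0.
Qed.
HB.instance Definition _ := GRing.isSubmodClosed.Build R U ker_pred ker_closed.

End Kernel.

Definition ker U V (f : {linear U -> V}) : lmodType R := submod (ker_pred f).

Section Homology.
Variables (A B C : lmodType R) (f : {linear A -> B}) (g : {linear B -> C}).

Definition bnd_pred : {pred ker g} := fun z => `[< exists x, f x = val z >].

Fact bnd_closed : submod_closed bnd_pred.
Proof.
split=> [|a x y]; first by apply/asboolP; exists 0; rewrite linear0 raddf0.
move=> /asboolP[u fu] /asboolP[v fv]; apply/asboolP; exists (a *: u + v).
by rewrite linearP fu fv.
Qed.
HB.instance Definition _ :=
  GRing.isSubmodClosed.Build R (ker g) bnd_pred bnd_closed.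

(* ker g / (im f :&: ker g); in all uses below g \o f = 0. *)
Definition homology : lmodType R := quotmod bnd_pred.

End Homology.

Section Free.
Variables (X : choiceType) (V : lmodType R) (h : X -> V).

Definition free_lift (u : malg X R) : V := \sum_(x <- msupp u) mcoeff x u *: h x.

Fact free_liftEw (d : {fset X}) u : (msupp u `<=` d)%fset ->
  free_lift u = \sum_(x <- d) mcoeff x u *: h x.
Proof.
move=> le; rewrite [LHS](big_fset_incl _ le) // => x _ /mcoeff_outdom ->.
by rewrite scale0r.
Qed.

Fact free_lift_is_linear : linear free_lift.
Proof.
move=> a u v; set d := (msupp u `|` msupp v `|` msupp (a *: u + v))%fset.
rewrite !(@free_liftEw d) ?fsubsetUr//; first last.
- by rewrite /d -fsetUA fsubsetUl.
- by rewrite /d fsetUC fsetUA fsubsetUr.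
rewrite scaler_sumr -big_split; apply: eq_bigr => x _ /=.
by rewrite mcoeffD mcoeffZ scalerDl scalerA.
Qed.
HB.instance Definition _ :=
  GRing.isLinear.Build R (malg X R) V _ free_lift free_lift_is_linear.

Lemma free_liftU x : free_lift (mkmalgU x 1) = h x.
Proof. by rewrite (free_liftEw msuppU_le) big_seq_fset1 mcoeffUU scale1r. Qed.

End Free.

Section Span.
Variables (V : lmodType R) (S : set V).

Definition span_pred : {pred V} := fun x =>
  `[< forall W : submodClosed V, (forall y, S y -> y \in W) -> x \in W >].

Fact span_closed : submod_closed span_pred.
Proof.
split=> [|a x y]; first by apply/asboolP => W _; rewrite rpred0.
move=> /asboolP Sx /asboolP Sy; apply/asboolP => W SW.
by rewrite rpredD ?rpredZ ?Sx ?Sy.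
Qed.
HB.instance Definition _ := GRing.isSubmodClosed.Build R V span_pred span_closed.

End Span.

Section Tensor.
Variables M N : lmodType R.

Let gen (m : M) (n : N) : malg (M * N)%type R := mkmalgU (m, n) 1.

Inductive bilin_rel : malg (M * N)%type R -> Prop :=
| BilinDl m m' n : bilin_rel (gen (m + m') n - gen m n - gen m' n)
| BilinDr m n n' : bilin_rel (gen m (n + n') - gen m n - gen m n')
| BilinZl a m n : bilin_rel (gen (a *: m) n - a *: gen m n)
| BilinZr a m n : bilin_rel (gen m (a *: n) - a *: gen m n).

Definition tensor : lmodType R := quotmod (span_pred bilin_rel).

Definition tpure (m : M) (n : N) : tensor := qpi (span_pred bilin_rel) (gen m n).

Lemma tensor_rel x : bilin_rel x -> qpi (span_pred bilin_rel) x = 0.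
Proof.
move=> xr; rewrite -[RHS](linear0 (qpi _)); apply/qpiP; rewrite subr0.
by apply/asboolP => W; apply.
Qed.

Lemma tpureDl m m' n : tpure (m + m') n = tpure m n + tpure m' n.
Proof.
apply/eqP; rewrite -subr_eq0 opprD addrA -!linearB; apply/eqP.
exact/tensor_rel/BilinDl.
Qed.
Lemma tpureDr m n n' : tpure m (n + n') = tpure m n + tpure m n'.
Proof.
apply/eqP; rewrite -subr_eq0 opprD addrA -!linearB; apply/eqP.
exact/tensor_rel/BilinDr.
Qed.
Lemma tpureZl a m n : tpure (a *: m) n = a *: tpure m n.
Proof.
apply/eqP; rewrite -subr_eq0 -linearZ -linearB; apply/eqP.
exact/tensor_rel/BilinZl.
Qed.
Lemma tpureZr a m n : tpure m (a *: n) = a *: tpure m n.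
Proof.
apply/eqP; rewrite -subr_eq0 -linearZ -linearB; apply/eqP.
exact/tensor_rel/BilinZr.
Qed.

End Tensor.

Section TensorMap.
Variables (M M' N : lmodType R) (f : {linear M -> M'}).

Let lft : malg (M * N)%type R -> tensor M' N :=
  free_lift (fun p => tpure (f p.1) p.2).

(* f \otimes id_N *)
Definition tensor_map (t : tensor M N) : tensor M' N := lft (repr t).

Fact lft_span x : x \in span_pred (@bilin_rel M N) -> lft x = 0.
Proof.
move=> /asboolP/(_ (ker_pred (free_lift (fun p => tpure (f p.1) p.2)))) H.
apply/eqP/H => _ [m m' n|m n n'|a m n|a m n]; rewrite unfold_in; apply/eqP;
  rewrite ?linearB ?linearZ /= !free_liftU /=.
- by rewrite linearD tpureDl addrAC addrK subrr.
- by rewrite tpureDr addrAC addrK subrr.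
- by rewrite linearZ tpureZl scalerN subrr.
- by rewrite tpureZr scalerN subrr.
Qed.

Fact tensor_map_pi x : tensor_map (qpi _ x) = lft x.
Proof.
apply/eqP; rewrite -subr_eq0 /tensor_map /lft -linearB; apply/eqP.
by apply: lft_span; apply/qpiP; rewrite qpi_repr.
Qed.

Lemma tensor_map_pure m n : tensor_map (tpure m n) = tpure (f m) n.
Proof. by rewrite tensor_map_pi /lft free_liftU. Qed.

Fact tensor_map_is_linear : linear tensor_map.
Proof.
move=> a x y; rewrite -[x]qpi_repr -[y]qpi_repr -linearP !tensor_map_pi.
by rewrite /lft linearP.
Qed.
HB.instance Definition _ := GRing.isLinear.Build R (tensor M N) (tensor M' N) _
  tensor_map tensor_map_is_linear.

End TensorMap.
Arguments tensor_map {M M'} N f t.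

Section Hom.
Variables U V : lmodType R.

Definition hom_pred : {pred U -> V} := fun f => `[< linear f >].

Fact hom_closed : submod_closed hom_pred.
Proof.
split=> [|a f g]; first by apply/asboolP => b x y; rewrite scaler0 addr0.
move=> /asboolP fl /asboolP gl; apply/asboolP => b x y.
change (a *: f (b *: x + y) + g (b *: x + y) =
  b *: (a *: f x + g x) + (a *: f y + g y)).
by rewrite fl gl !scalerDr !scalerA [b * a]mulrC addrACA.
Qed.
HB.instance Definition _ :=
  GRing.isSubmodClosed.Build R (U -> V) hom_pred hom_closed.

Definition hom : lmodType R := submod hom_pred.

End Hom.

Section HomMap.
Variables (U U' V : lmodType R) (f : {linear U -> U'}).

Fact hom_map_subproof (g : hom U' V) : (val g : U' -> V) \o f \in @hom_pred U V.
Proof.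
apply/asboolP => a x y /=; rewrite linearP.
exact: (asboolP _ (valP g)).
Qed.

(* Hom(f, V) *)
Definition hom_map (g : hom U' V) : hom U V :=
  exist (fun h => h \in hom_pred (V:=V)) _ (hom_map_subproof g).

Fact hom_map_is_linear : linear hom_map.
Proof. by move=> a g h; apply: val_inj; apply: funext. Qed.
HB.instance Definition _ := GRing.isLinear.Build R (hom U' V) (hom U V) _
  hom_map hom_map_is_linear.

End HomMap.
Arguments hom_map {U U'} V f g.


(* Homology of X \otimes N and cohomology of Hom(X, N) for a complex
   ... -> X 2 -> X 1 -> X 0 -> 0. *)
Section ChainFunctors.
Variables (X : nat -> lmodType R) (d : forall n, {linear X n.+1 -> X n}).
Variable N : lmodType R.

Definition tensor_homology (i : nat) : lmodType R :=
  match i with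
  | 0 => homology (tensor_map N (d 0)) (\0 : {linear tensor (X 0) N -> tensor (X 0) N})
  | j.+1 => homology (tensor_map N (d j.+1)) (tensor_map N (d j))
  end.

Definition hom_cohomology (i : nat) : lmodType R :=
  match i with
  | 0 => homology (\0 : {linear hom (X 0) N -> hom (X 0) N}) (hom_map N (d 0))
  | j.+1 => homology (hom_map N (d j)) (hom_map N (d j.+1))
  end.

End ChainFunctors.

(* The standard free resolution of M: cover M by the free module on its
   elements, then do the same with the kernel, and so on. *)
Section FreeResolution.
Variable M : lmodType R.

Definition free_cover (V : lmodType R) : {linear malg V R -> V} :=
  free_lift (id : V -> V).

Fixpoint syz (n : nat) : lmodType R :=
  if n is n'.+1 then ker (free_cover (syz n')) else M.

Definition fres (n : nat) : lmodType R := malg (syz n) R.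

Definition fres_d (n : nat) (x : fres n.+1) : fres n :=
  val (free_cover (syz n.+1) x).

Fact fres_d_is_linear n : linear (@fres_d n).
Proof. by move=> a x y; rewrite /fres_d linearP. Qed.
HB.instance Definition _ n := GRing.isLinear.Build R (fres n.+1) (fres n) _
  (@fres_d n) (@fres_d_is_linear n).

Lemma free_cover_surj (V : lmodType R) (v : V) : exists x, free_cover V x = v.
Proof. by exists (mkmalgU v 1); rewrite /= free_liftU. Qed.

Lemma fres_exact0 (x : fres 0) :
  free_cover M x = 0 <-> exists y : fres 1, fres_d y = x.
Proof.
split=> [x0|[y <-]]; last by apply/eqP; exact: valP (free_cover (syz 1) y).
have xk : x \in ker_pred (free_cover M) by rewrite unfold_in x0.
have [y ye] := @free_cover_surj (syz 1) (Sub x xk).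
by exists y; rewrite /fres_d ye.
Qed.

Lemma fres_exact n (x : fres n.+1) :
  fres_d x = 0 <-> exists y : fres n.+2, fres_d y = x.
Proof.
split=> [x0|[y <-]]; last first.
  by have /eqP e := valP (free_cover (syz n.+2) y); rewrite /fres_d e.
have xk : x \in ker_pred (free_cover (syz n.+1)).
  by rewrite unfold_in; apply/eqP/val_inj.
have [y ye] := @free_cover_surj (syz n.+2) (Sub x xk).
by exists y; rewrite /fres_d ye.
Qed.

End FreeResolution.

(* Computed from the standard free resolution of the first argument; any other
   projective resolution gives isomorphic modules. *)
Definition Tor (i : nat) (M N : lmodType R) : lmodType R :=
  tensor_homology (@fres_d M) N i.

Definition Ext (i : nat) (M N : lmodType R) : lmodType R :=
  hom_cohomology (@fres_d M) N i.

Definition grade (M N : lmodType R) : \bar int :=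
  infimum +oo%E [set i%:Z%:E | i in [set i : nat | nonzero_module (Ext i M N)]].

Definition grade1 (M : lmodType R) : \bar int := grade M R^o.

Definition qTor (M N : lmodType R) : \bar int :=
  supremum -oo%E [set i%:Z%:E | i in [set i : nat | nonzero_module (Tor i M N)]].

End Modules.

Section Complexes.
Variable R : comNzRingType.

(* cplx_d X i j is the differential when i = j + 1, and 0 otherwise; this
   avoids casts between X ((i - 1) + 1) and X i. *)
Record complex := Complex {
  cplx_ob :> int -> lmodType R;
  cplx_d : forall i j, {linear cplx_ob i -> cplx_ob j};
  cplx_shape : forall i j, i != j + 1 -> forall x, cplx_d i j x = 0;
  cplx_dd : forall i j k x, cplx_d j k (cplx_d i j x) = 0 }.

Implicit Type X : complex.

Definition cplx_homology X (i : int) : lmodType R :=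
  homology (cplx_d X (i + 1) i) (cplx_d X i (i - 1)).

Definition csup X : \bar int :=
  supremum -oo%E [set i%:E | i in [set i : int | nonzero_module (X i)]].
Definition cinf X : \bar int :=
  infimum +oo%E [set i%:E | i in [set i : int | nonzero_module (X i)]].
Definition chsup X : \bar int :=
  supremum -oo%E
    [set i%:E | i in [set i : int | nonzero_module (cplx_homology X i)]].

Definition bounded_below X : Prop := (-oo < cinf X)%E.
Definition bounded X : Prop := (csup X - cinf X < +oo)%E.

Definition quasi_proj_resolution (M : lmodType R) (P : complex) : Prop :=
  [/\ bounded_below P,
      forall i, fin_gen (P i) /\ projective (P i)
    & exists a : int -> nat,
        (exists2 i, (cinf P <= i%:E)%E & a i != 0%N) /\
        forall i, (cinf P <= i%:E)%E ->
          isomorphic (cplx_homology P i) {ffun 'I_(a i) -> M}].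

(* Meaningful for M nonzero; +oo when there is no bounded resolution. *)
Definition qpd (M : lmodType R) : \bar int :=
  infimum +oo%E
    [set x | exists P : complex,
      [/\ quasi_proj_resolution M P, bounded P & x = (csup P - chsup P)%E]].

Definition quasi_perfect (M : lmodType R) : Prop :=
  (qpd M < +oo)%E /\ qpd M = grade1 M.

End Complexes.

Section Localization.
Variables (R : comNzRingType) (p : prime_idealr R) (V : lmodType R).

Definition pcompl := {s : R | s \notin p}.

Fact pcompl1_subproof : 1 \notin p. Proof. by rewrite idealr1. Qed.
Definition pcompl1 : pcompl := exist (fun s => s \notin p) 1 pcompl1_subproof.

Fact pcomplM_subproof (s t : pcompl) : sval s * sval t \notin p.
Proof. by rewrite prime_idealrM negb_or (valP s) (valP t). Qed.
Definition pcomplM (s t : pcompl) : pcompl :=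
  exist (fun s => s \notin p) _ (pcomplM_subproof s t).

(* (x, s) stands for the fraction x / s *)
Definition frac_eq (f g : V * pcompl) : bool :=
  `[< exists u : pcompl, sval u *: (sval g.2 *: f.1 - sval f.2 *: g.1) = 0 >].

Fact frac_eqP (f g : V * pcompl) :
  reflect (exists u : pcompl, (sval u * sval g.2) *: f.1 = (sval u * sval f.2) *: g.1)
          (frac_eq f g).
Proof.
apply: (iffP (asboolP _)) => -[u uP]; exists u.
  by apply/eqP; rewrite -subr_eq0 -!scalerA -scalerBr uP.
by rewrite scalerBr !scalerA uP subrr.
Qed.

Fact frac_eq_refl : reflexive frac_eq.
Proof. by move=> f; apply/frac_eqP; exists pcompl1. Qed.

Fact frac_eq_sym : symmetric frac_eq.
Proof. by move=> f g; apply/frac_eqP/frac_eqP => -[u uP]; exists u. Qed.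

Fact frac_eq_trans : transitive frac_eq.
Proof.
move=> [y t] [x s] [z w] /frac_eqP[u /= uP] /frac_eqP[v /= vP].
apply/frac_eqP; exists (pcomplM (pcomplM u v) t) => /=.
have -> : sval u * sval v * sval t * sval w = (sval v * sval w) * (sval u * sval t) by ring.
rewrite -scalerA uP scalerA.
have -> : sval v * sval w * (sval u * sval s) = (sval u * sval s) * (sval v * sval w) by ring.
by rewrite -scalerA vP scalerA; congr (_ *: _); ring.
Qed.

Canonical frac_equiv := EquivRel frac_eq frac_eq_refl frac_eq_sym frac_eq_trans.

(* V_p, with its R-module structure only; this is enough for in_supp below *)
Definition localization := {eq_quot frac_eq}.
HB.instance Definition _ := EqQuotient.on localization.
HB.instance Definition _ := Choice.on localization.

Definition lfrac (x : V) (s : pcompl) : localization :=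
  \pi_({eq_quot frac_eq}) (x, s).

Lemma eq_frac x s y t :
  lfrac x s = lfrac y t <->
  exists u : pcompl, (sval u * sval t) *: x = (sval u * sval s) *: y.
Proof. by split=> [/eqmodP/frac_eqP//|H]; apply/eqmodP/frac_eqP. Qed.

Lemma frac_repr (f : localization) : lfrac (repr f).1 (repr f).2 = f.
Proof. by rewrite /lfrac -surjective_pairing reprK. Qed.

Definition loc_add (f g : localization) : localization :=
  lfrac (sval (repr g).2 *: (repr f).1 + sval (repr f).2 *: (repr g).1)
       (pcomplM (repr f).2 (repr g).2).
Definition loc_opp (f : localization) : localization :=
  lfrac (- (repr f).1) (repr f).2.
Definition loc_scale (a : R) (f : localization) : localization :=
  lfrac (a *: (repr f).1) (repr f).2.

Lemma loc_addE x s y t :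
  loc_add (lfrac x s) (lfrac y t) = lfrac (sval t *: x + sval s *: y) (pcomplM s t).
Proof.
rewrite /loc_add; have := frac_repr (lfrac x s); have := frac_repr (lfrac y t).
case: (repr (lfrac x s)) => x' s' /=; case: (repr (lfrac y t)) => y' t' /=.
move=> /eq_frac[v vP] /eq_frac[u uP]; apply/eq_frac; exists (pcomplM u v) => /=.
rewrite !scalerDr !scalerA; congr (_ + _).
  have -> : sval u * sval v * (sval s * sval t) * sval t' =
    (sval v * sval t * sval t') * (sval u * sval s) by ring.
  by rewrite -scalerA uP scalerA; congr (_ *: _); ring.
have -> : sval u * sval v * (sval s * sval t) * sval s' =
  (sval u * sval s * sval s') * (sval v * sval t) by ring.
by rewrite -scalerA vP scalerA; congr (_ *: _); ring.
Qed.

Lemma loc_oppE x s : loc_opp (lfrac x s) = lfrac (- x) s.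
Proof.
rewrite /loc_opp; have := frac_repr (lfrac x s).
case: (repr (lfrac x s)) => x' s' /= /eq_frac[u uP].
by apply/eq_frac; exists u; rewrite !scalerN uP.
Qed.

Lemma loc_scaleE a x s : loc_scale a (lfrac x s) = lfrac (a *: x) s.
Proof.
rewrite /loc_scale; have := frac_repr (lfrac x s).
case: (repr (lfrac x s)) => x' s' /= /eq_frac[u uP].
have swap b (v : V) : b *: (a *: v) = a *: (b *: v) by rewrite !scalerA mulrC.
by apply/eq_frac; exists u; rewrite !swap uP.
Qed.

Fact loc_addA : associative loc_add.
Proof.
move=> f g h; rewrite -[f]frac_repr -[g]frac_repr -[h]frac_repr !loc_addE.
apply/eq_frac; exists pcompl1; rewrite /= !scalerDr !scalerA addrA.
by congr (_ *: _ + _ *: _ + _ *: _); ring.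
Qed.
Fact loc_addC : commutative loc_add.
Proof.
move=> f g; rewrite -[f]frac_repr -[g]frac_repr !loc_addE.
apply/eq_frac; exists pcompl1; rewrite /= addrC !scalerDr !scalerA.
by congr (_ *: _ + _ *: _); ring.
Qed.
Fact loc_add0 : left_id (lfrac 0 pcompl1) loc_add.
Proof.
move=> f; rewrite -[f]frac_repr loc_addE.
by apply/eq_frac; exists pcompl1; rewrite /= scaler0 add0r !scalerA !mulr1 !mul1r.
Qed.
Fact loc_addN : left_inverse (lfrac 0 pcompl1) loc_opp loc_add.
Proof.
move=> f; rewrite -[f]frac_repr loc_oppE loc_addE.
by apply/eq_frac; exists pcompl1; rewrite /= scalerN addNr !scaler0.
Qed.
HB.instance Definition _ :=
  GRing.isZmodule.Build localization loc_addA loc_addC loc_add0 loc_addN.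

Fact loc_scaleA a b f : loc_scale a (loc_scale b f) = loc_scale (a * b) f.
Proof. by rewrite -[f]frac_repr !loc_scaleE scalerA. Qed.
Fact loc_scale1 : left_id 1 loc_scale.
Proof. by move=> f; rewrite -[f]frac_repr loc_scaleE scale1r. Qed.
Fact loc_scaleDr : right_distributive loc_scale loc_add.
Proof.
move=> a f g; rewrite -[f]frac_repr -[g]frac_repr !(loc_scaleE, loc_addE).
apply/eq_frac; exists pcompl1; rewrite !scalerDr !scalerA.
by congr (_ *: _ + _ *: _); ring.
Qed.
Fact loc_scaleDl f a b :
  loc_scale (a + b) f = loc_add (loc_scale a f) (loc_scale b f).
Proof.
rewrite -[f]frac_repr !loc_scaleE loc_addE.
apply/eq_frac; exists pcompl1; rewrite /= !scalerDl !scalerDr !scalerA.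
by congr (_ *: _ + _ *: _); ring.
Qed.
HB.instance Definition _ := GRing.Zmodule_isLmodule.Build R localization
  loc_scaleA loc_scale1 loc_scaleDr loc_scaleDl.

End Localization.

Section Rings.
Variable R : comNzRingType.

Definition in_supp (V : lmodType R) (p : prime_idealr R) : Prop :=
  nonzero_module (localization p V).

Definition supp_sub (U V : lmodType R) : Prop :=
  forall p, in_supp U p -> in_supp V p.

Definition noetherian_ring : Prop :=
  forall I : submodClosed R^o, fin_gen (submod I).

(* an idealr is a proper ideal *)
Definition maximal_ideal (m : idealr R) : Prop :=
  forall I : idealr R, {subset m <= I} -> I =i m.

Definition local_ring : Prop :=
  exists m : idealr R,
    maximal_ideal m /\ forall m' : idealr R, maximal_ideal m' -> m' =i m.

End Rings.

(* Main.v *)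
(* Let P be a bounded quasi-projective resolution of N, with top t and homological
   supremum s. Since Tor_i(M, N) = 0 for i > 0, the cycles and boundaries of P are
   also Tor-independent of M, so M (x) P is a complex whose terms are summands of
   powers of M and whose homology modules are powers of M (x) N. Chasing
   Ext(L, -) through its cycles and boundaries, from the bottom with the homology
   and from the top with the exactness above s, gives (1).

   For (2), let g = grade(L, M) and let p be the annihilator of a class xi in
   Ext^g(L, M), chosen prime; then p lies in Supp L, hence in Supp N. Instead of
   passing to a minimal complex over R_p, work over R up to multiplication by
   elements outside p, and replace P by its truncation at the lowest level r >= s
   at which the cokernel W of P_(r+1) -> P_r is still projective at p. Then
   W -> P_(r-1) does not split at p, so some x in W, nonzero in the fibre of W at
   p, is mapped into p P_(r-1). The argument of (1) with (N, R) in place of (L, M),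
   where Hom(N, N) does not vanish at p, gives grade N <= r - s. The image of xi
   under x (x) - is nonzero at p and dies in Ext^g(L, M (x) P_(r-1)), which the same
   chase forbids unless g >= grade(L, M (x) N) + (r - s). *)

From HB Require Import structures.
From mathcomp Require Import all_boot all_order all_fingroup all_algebra.
From mathcomp Require Import generic_quotient ring_quotient finmap.
From mathcomp Require Import boolp classical_sets functions.
From mathcomp Require Import constructive_ereal ring zify.
From mathcomp Require Import -(notations) monalg.
Require Import Defs.

Set Implicit Arguments.
Unset Strict Implicit.
Unset Printing Implicit Defensive.

Import Order.TTheory GRing.Theory Num.Theory.

Local Open Scope ring_scope.

Section LinearMaps.
Variable R : comNzRingType.
Implicit Types U V W X : lmodType R.

Definition mklin U V (f : U -> V) (fl : linear f) : {linear U -> V} :=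
  HB.pack f (GRing.isLinear.Build R U V _ f fl).

Definition surj U V (f : U -> V) := forall y, exists x, f x = y.

Lemma lift_surj U V X (q : {linear U -> V}) (f : {linear U -> X}) :
  surj q -> (forall x, q x = 0 -> f x = 0) ->
  exists f' : {linear V -> X}, forall x, f' (q x) = f x.
Proof.
move=> qs qf; have [s sP] := choice qs.
have fE x y : q x = q y -> f x = f y.
  move=> e; apply/eqP; rewrite -subr_eq0 -linearB; apply/eqP/qf.
  by rewrite linearB e subrr.
have sl : linear (f \o s).
  by move=> a x y /=; rewrite -linearP; apply: fE; rewrite linearP !sP.
by exists (mklin sl) => x; apply: fE; rewrite sP.
Qed.

Lemma lift_inj U V X (i : {linear U -> V}) (f : {linear X -> V}) :
  injective i -> (forall x, exists y, i y = f x) ->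
  exists f' : {linear X -> U}, forall x, i (f' x) = f x.
Proof.
move=> ii /choice[s sP].
have sl : linear s by move=> a x y; apply: ii; rewrite linearP !sP linearP.
by exists (mklin sl).
Qed.

Lemma lin_inj U V (f : {linear U -> V}) :
  (forall x, f x = 0 -> x = 0) <-> injective f.
Proof.
split=> [f0 x y e|fi x fx]; last by apply: fi; rewrite fx linear0.
by apply/eqP; rewrite -subr_eq0; apply/eqP/f0; rewrite linearB e subrr.
Qed.

Definition ses U V W (f : {linear U -> V}) (g : {linear V -> W}) :=
  [/\ injective f, surj g & forall y, g y = 0 <-> exists x, f x = y].

Definition img_pred U V (f : {linear U -> V}) : {pred V} :=
  fun y => `[< exists x, f x = y >].

Fact img_closed U V (f : {linear U -> V}) : submod_closed (img_pred f).
Proof.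
split=> [|a x y]; first by apply/asboolP; exists 0; rewrite linear0.
move=> /asboolP[u fu] /asboolP[v fv]; apply/asboolP; exists (a *: u + v).
by rewrite linearP fu fv.
Qed.
HB.instance Definition _ U V (f : {linear U -> V}) :=
  GRing.isSubmodClosed.Build R V (img_pred f) (img_closed f).

Definition coker U V (f : {linear U -> V}) : lmodType R := quotmod (img_pred f).
Definition cokpi U V (f : {linear U -> V}) : {linear V -> coker f} :=
  qpi (img_pred f).

Lemma qpi0 V (S : submodClosed V) x : (qpi S x = 0) <-> x \in S.
Proof.
split=> [e|xS]; last by rewrite -(linear0 (qpi S)); apply/qpiP; rewrite subr0.
by rewrite -[x]subr0; apply/qpiP; rewrite e linear0.
Qed.

Lemma qpi_surj V (S : submodClosed V) : surj (qpi S).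
Proof. by move=> y; exists (repr y); rewrite qpi_repr. Qed.

Lemma cokpi0 U V (f : {linear U -> V}) y :
  cokpi f y = 0 <-> exists x, f x = y.
Proof.
split=> [/qpi0 yf|yf]; first exact/asboolP.
by apply/(qpi0 (img_pred f)); exact/asboolP.
Qed.

Lemma mkmalgU_scale (X : choiceType) (x : X) (c : R) :
  mkmalgU x c = c *: mkmalgU x 1 :> malg X R.
Proof. by apply/malgP => k; rewrite mcoeffZ !mcoeffU mulrnAr mulr1. Qed.

Lemma free_eq (X : choiceType) V (f g : {linear malg X R -> V}) :
  (forall x, f (mkmalgU x 1) = g (mkmalgU x 1)) -> forall u, f u = g u.
Proof.
move=> fg u; rewrite [u]monalgE !linear_sum; apply: eq_bigr => x _.
by rewrite mkmalgU_scale !linearZ fg.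
Qed.

Lemma free_projective (X : choiceType) : projective (malg X R).
Proof.
move=> V W p f ps; have [s sP] := choice ps.
exists (free_lift (fun x => s (f (mkmalgU x 1)))).
apply: (@free_eq _ _ (p \o free_lift (fun x => s (f (mkmalgU x 1)))) f) => x /=.
by rewrite free_liftU.
Qed.

End LinearMaps.

Definition mult_set (R : comNzRingType) (S : R -> Prop) :=
  S 1 /\ forall a b, S a -> S b -> S (a * b).

(* [V] is a direct summand of a power of [W] up to multiplication by an element
   of [S]; for [S] the complement of a prime [p] and [W = R], this is a substitute
   for projectivity of the localization [V_p], and [S = {1}] is the plain notion. *)
Definition ssum (R : comNzRingType) (S : R -> Prop) (V W : lmodType R) :=
  exists n (u : 'I_n -> {linear V -> W}) (v : 'I_n -> {linear W -> V}) a,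
    S a /\ forall x, \sum_i v i (u i x) = a *: x.

(** * Cohomology of Hom(X, -) up to a multiplicative set *)

Section Cohomology.
Variables (R : comNzRingType) (S : R -> Prop) (mS : mult_set S).
Variables (X : nat -> lmodType R) (d : forall n, {linear X n.+1 -> X n}).
Hypotheses (dd : forall n x, d n (d n.+1 x) = 0).
Hypotheses (pX : forall n, projective (X n)) (X0 : forall x : X 0, x = 0).
Implicit Types A B C : lmodType R.

Definition cocycle i A (z : X i.+1 -> A) := forall x, z (d i.+1 x) = 0.
Definition cobound i A (z : X i.+1 -> A) :=
  exists (s : R) (w : {linear X i -> A}), S s /\ forall x, s *: z x = w (d i x).
(* [Ext^i(-, A)], resp. the kernel of [Ext^i(-, f)], is annihilated elementwise by
   [S]. *)
Definition Enull i A := forall z : {linear X i.+1 -> A}, cocycle z -> cobound z.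
Definition Evan g A := forall i, (i < g)%N -> Enull i A.
Definition Einj i A B (f : A -> B) := forall z : {linear X i.+1 -> A},
  cocycle z -> cobound (f \o z) -> cobound z.

Lemma Evan_le g g' A : (g' <= g)%N -> Evan g A -> Evan g' A.
Proof. by move=> le Ag i ig; apply/Ag/(leq_trans ig). Qed.

Lemma Enull0 i A : (forall x : A, x = 0) -> Enull i A.
Proof. by move=> A0 z _; exists 1, \0; split=> [|x]; [case: mS|apply: A0]. Qed.

Section Ses.
Variables (A B C : lmodType R) (f : {linear A -> B}) (g : {linear B -> C}).
Hypothesis fg : ses f g.
Let gf x : g (f x) = 0.
Proof. by case: fg => _ _ /(_ (f x)) [_]; apply; exists x. Qed.

Lemma Einj_ses0 : Einj 0 f.
Proof.
case: fg => fi _ _ z zd [s [w [Ss wP]]]; exists s, \0; split=> // x.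
by apply: fi; rewrite linearZ /= wP (X0 (d 0 x)) !linear0.
Qed.

Lemma Einj_sesl i : Enull i C -> Einj i.+1 f.
Proof.
case: fg => fi gs ex Cn z zd [s [w [Ss wP]]].
have [|t [v [St vP]]] := Cn (g \o w).
  by move=> x /=; rewrite -wP /= linearZ /= gf scaler0.
have [v' v'P] := @pX i _ _ g v gs.
have [|w' w'P] := @lift_inj _ _ _ _ f ((t \*: w) \- (v' \o d i)) fi.
  by move=> x; apply/ex; rewrite /= linearB linearZ /= v'P -vP subrr.
exists (t * s), w'; split; first by apply: mS.2.
move=> x; apply: fi; rewrite w'P /= dd linear0 subr0 -wP linearZ /=.
by rewrite scalerA.
Qed.

Lemma Enull_left i : Enull i C -> Enull i.+1 B -> Enull i.+1 A.
Proof.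
move=> Cn Bn z zd; apply: Einj_sesl => //.
by apply: (Bn (f \o z)) => x /=; rewrite zd linear0.
Qed.

Lemma Enull_left0 : Enull 0 B -> Enull 0 A.
Proof.
move=> Bn z zd; apply: Einj_ses0 => //.
by apply: (Bn (f \o z)) => x /=; rewrite zd linear0.
Qed.

Lemma Einj_sesr i : Enull i A -> Einj i g.
Proof.
case: fg => fi gs ex An z zd [s [v [Ss vP]]].
have [v' v'P] := @pX i _ _ g v gs.
have [|z1 z1P] := @lift_inj _ _ _ _ f ((s \*: z) \- (v' \o d i)) fi.
  by move=> x; apply/ex; rewrite /= linearB linearZ /= v'P -vP subrr.
have [|t [w [St wP]]] := An z1.
  by move=> x; apply: fi; rewrite z1P /= linear0 zd scaler0 dd linear0 subr0.
exists (t * s), ((f \o w) \+ (t \*: v')); split; first by apply: mS.2.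
by move=> x /=; rewrite -wP linearZ /= z1P /= scalerBr scalerA addrNK.
Qed.

Lemma Enull_mid i : Enull i A -> Enull i C -> Enull i B.
Proof.
move=> An Cn z zd; apply: (Einj_sesr An zd).
by apply: (Cn (g \o z)) => x /=; rewrite zd linear0.
Qed.

Lemma Enull_right i : Enull i B -> Enull i.+1 A -> Enull i C.
Proof.
case: fg => fi gs ex Bn An z zd.
have [z' z'P] := @pX i.+1 _ _ g z gs.
have [|y yP] := @lift_inj _ _ _ _ f (z' \o d i.+1) fi.
  by move=> x; apply/ex; rewrite /= z'P zd.
have [|s [w [Ss wP]]] := An y.
  by move=> x; apply: fi; rewrite yP /= dd !linear0.
have [|t [v [St vP]]] := Bn ((s \*: z') \- (f \o w)).
  move=> x /=; rewrite -wP linearZ /= yP /= subrr //.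
exists (t * s), (g \o v); split; first by apply: mS.2.
move=> x /=; rewrite -vP /= linearZ linearB linearZ /= z'P gf subr0.
by rewrite scalerA.
Qed.

Lemma Evan_mid n : Evan n A -> Evan n C -> Evan n B.
Proof. by move=> An Cn i ig; apply: Enull_mid; [exact: An|exact: Cn]. Qed.

Lemma Evan_right n : Evan n B -> Evan n.+1 A -> Evan n C.
Proof. by move=> Bn An i ig; apply: Enull_right; [exact: Bn|exact: An]. Qed.

Lemma Evan_left n : Evan n B -> Evan n.-1 C -> Evan n A.
Proof.
move=> Bn Cn [|i] ig; first exact/Enull_left0/Bn.
by apply: Enull_left; [apply: Cn; lia|exact: Bn].
Qed.

Lemma Einj_left n i : Evan n C -> (i <= n)%N -> Einj i f.
Proof.
by move=> Cn; case: i => [|i] ig; [exact: Einj_ses0|exact/Einj_sesl/Cn].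
Qed.

End Ses.

Lemma Einj_comp i A B C (f : {linear A -> B}) (g : {linear B -> C}) :
  Einj i f -> Einj i g -> Einj i (g \o f).
Proof.
move=> fi gi z zd zb; apply: fi => //.
by apply: (gi (f \o z)) => // x /=; rewrite zd linear0.
Qed.

Lemma Enull_ssum i V W : ssum S V W -> Enull i W -> Enull i V.
Proof.
move=> [n [u [v [a [Sa uv]]]]] Wn z zd.
have /choice[s sP] j : exists s, exists w : {linear X i -> W}, S s /\
    forall x, s *: u j (z x) = w (d i x).
  by apply: (Wn (u j \o z)) => x /=; rewrite zd linear0.
have [w wP] := choice sP.
have Sprod (I : Type) (r : seq I) (P : pred I) F : (forall j, S (F j)) ->
    S (\prod_(j <- r | P j) F j).
  by move=> SF; apply: big_ind => //; case: mS.
have lw : linear (fun y => \sum_j (\prod_(k | k != j) s k) *: v j (w j y)).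
  move=> b x y; rewrite scaler_sumr -big_split; apply: eq_bigr => j _ /=.
  have -> : v j (w j (b *: x + y)) = b *: v j (w j x) + v j (w j y).
    by rewrite !linearP.
  by rewrite scalerDr !scalerA mulrC.
exists ((\prod_j s j) * a), (mklin lw); split.
  by apply: mS.2 => //; apply: Sprod => j; case: (wP j).
move=> x /=; rewrite -scalerA -uv scaler_sumr; apply: eq_bigr => j _.
by rewrite -(wP j).2 linearZ /= scalerA (bigD1 j) //= [s j * _]mulrC.
Qed.

Lemma Evan_ssum n V W : ssum S V W -> Evan n W -> Evan n V.
Proof. by move=> VW Wn i /Wn; exact: Enull_ssum. Qed.

(* A bounded-below complex [D] with homology [H], cut at level [r] so that [W]
   is the cokernel of [D (r + 1) -> D r]. *)
Record cut_complex r (D H : nat -> lmodType R) (W : lmodType R) := CutComplex {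
  cyc : nat -> lmodType R;
  bnd : nat -> lmodType R;
  cinc : forall j, {linear cyc j -> D j};
  bpi : forall j, {linear D j -> bnd j};
  binc : forall j, {linear bnd j.+1 -> cyc j};
  hpi : forall j, {linear cyc j -> H j};
  hinc : {linear H r -> W};
  wpi : {linear W -> bnd r};
  bnd0 : forall x : bnd 0, x = 0;
  ses_cyc : forall j, (j < r)%N -> ses (cinc j) (bpi j);
  ses_hom : forall j, (j < r)%N -> ses (binc j) (hpi j);
  ses_top : ses hinc wpi }.

Section Cut.
Variables (r s g h : nat) (D H : nat -> lmodType R) (W : lmodType R).
Variable K : cut_complex r D H W.
Hypotheses (sr : (s <= r)%N) (Wg : Evan g W).
Hypotheses (Dg : forall j, (j < r)%N -> Evan g (D j)).
Hypotheses (Hh : forall j, (j <= r)%N -> Evan h (H j)).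
Hypotheses (Hs : forall j, (s < j <= r)%N -> forall x : H j, x = 0).

Let Hs' j n : (s < j <= r)%N -> Evan n (H j).
Proof. by move=> /Hs ? i _; exact: Enull0. Qed.

Lemma bnd_Evan j : (j <= r)%N -> Evan (minn g (h.+1 + (j - s.+1))) (bnd K j).
Proof.
elim: j => [|j IH] jr; first by move=> i _; apply/Enull0/bnd0.
apply: (Evan_left (ses_hom K jr)); last first.
  case: (ltnP s j) => sj; first by apply: Hs'; rewrite sj ltnW.
  by apply: Evan_le (Hh _); lia.
apply: (Evan_left (ses_cyc K jr)); first by apply: Evan_le (Dg jr); lia.
by apply: Evan_le (IH _); lia.
Qed.

Lemma cut_hom_Evan c : (c <= g - (r - s))%N -> (c <= h.+1)%N -> Evan c (H s).
Proof.
move=> cg ch; case: (posnP c) => [->//|c0].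
have Bs : Evan c.-1 (bnd K s) by apply: Evan_le (bnd_Evan sr); lia.
have down k : (k < r - s)%N -> Evan (g - k) (bnd K (r - k)).
  elim: k => [|k IH] kr.
    rewrite !subn0; apply: (Evan_right (ses_top K)) => //.
    by apply: Hs'; lia.
  have kr' : (r - k.+1 < r)%N by lia.
  apply: (Evan_right (ses_cyc K kr')); first by apply: Evan_le (Dg kr'); lia.
  apply: (Evan_mid (ses_hom K kr')); last by apply: Hs'; lia.
  have -> : (r - k.+1).+1 = (r - k)%N by lia.
  by apply: Evan_le (IH _); lia.
move: sr; rewrite leq_eqVlt => /orP[/eqP e|lt].
  rewrite e in Bs *; apply: (Evan_left (ses_top K)) => //.
  by apply: Evan_le Wg; lia.
apply: (Evan_right (ses_hom K lt)).
  apply: (Evan_left (ses_cyc K lt)) => //; apply: Evan_le (Dg lt); lia.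
have := down (r - s.+1)%N.
have -> : (r - (r - s.+1) = s.+1)%N by lia.
move=> E; apply: Evan_le (E _); lia.
Qed.

End Cut.

Lemma cut_top_Einj q s g h D H W (K : cut_complex q.+1 D H W) :
  (s <= q.+1)%N -> Evan g W -> (forall j, (j < q.+1)%N -> Evan g (D j)) ->
  (forall j, (j <= q.+1)%N -> Evan h (H j)) ->
  (forall j, (s < j <= q.+1)%N -> forall x : H j, x = 0) ->
  (g < h + (q.+1 - s))%N -> Einj g (cinc K q \o (binc K q \o wpi K)).
Proof.
move=> sq Wg Dg Hh Hs gh.
have Hs' n j : (s < j <= q.+1)%N -> Evan n (H j).
  by move=> /Hs ? i _; exact: Enull0.
apply: Einj_comp; first apply: Einj_comp.
- apply: (Einj_sesr (ses_top K)); move: sq; rewrite leq_eqVlt.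
  case/orP=> [/eqP e|lt]; last by apply: (Hs' g.+1); lia.
  by apply: (Hh q.+1); lia.
- apply: (Einj_left (ses_hom K (ltnSn q)) (n := g)) => //.
  case: (ltnP s q) => sq'; first by apply: Hs'; lia.
  by apply: Evan_le (Hh q _); lia.
- apply: (Einj_left (ses_cyc K (ltnSn q)) (n := g)) => //.
  have Bg := @bnd_Evan _ _ _ _ _ _ _ K sq Dg Hh Hs q (leqnSn q).
  by apply: Evan_le Bg; lia.
Qed.

End Cohomology.

(** * Tensor products *)

Section Tensor.
Variable R : comNzRingType.
Implicit Types A B C M N V W X : lmodType R.

Lemma tensor_ind M N (P : tensor M N -> Prop) :
  P 0 -> (forall x y, P x -> P y -> P (x + y)) -> (forall m n, P (tpure m n)) ->
  forall t, P t.
Proof.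
move=> P0 PD Pp t; rewrite -[t]qpi_repr [repr t]monalgE linear_sum.
apply: big_ind => // -[m n] _.
rewrite mkmalgU_scale; set c := mcoeff _ _.
by rewrite linearZ; have := Pp (c *: m) n; rewrite tpureZl.
Qed.

Lemma tpure0l M N (n : N) : tpure (0 : M) n = 0.
Proof. by rewrite -(scale0r (0 : M)) tpureZl scale0r. Qed.

Lemma tpure0r M N (m : M) : tpure m (0 : N) = 0.
Proof. by rewrite -(scale0r (0 : N)) tpureZr scale0r. Qed.

Lemma tpure_suml M N I (r : seq I) (F : I -> M) (n : N) :
  tpure (\sum_(i <- r) F i) n = \sum_(i <- r) tpure (F i) n.
Proof.
by elim: r => [|i r IH]; rewrite ?(big_nil, big_cons) ?tpure0l // tpureDl IH.
Qed.

Lemma tpure_sumr M N I (r : seq I) (F : I -> N) (m : M) :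
  tpure m (\sum_(i <- r) F i) = \sum_(i <- r) tpure m (F i).
Proof.
by elim: r => [|i r IH]; rewrite ?(big_nil, big_cons) ?tpure0r // tpureDr IH.
Qed.

Lemma tensor_eq M N V (f g : {linear tensor M N -> V}) :
  (forall m n, f (tpure m n) = g (tpure m n)) -> f =1 g.
Proof.
move=> fg; apply: tensor_ind => // [|x y fx fy]; first by rewrite !linear0.
by rewrite !linearD fx fy.
Qed.

Definition bilinear_map M N V (b : M -> N -> V) :=
  (forall m, linear (b m)) /\ forall n, linear (b^~ n).

Lemma tensor_lift M N V (b : M -> N -> V) : bilinear_map b ->
  exists f : {linear tensor M N -> V}, forall m n, f (tpure m n) = b m n.
Proof.
move=> [bl br].
have [|f fP] := @lift_surj _ _ _ _ (qpi (span_pred (@bilin_rel _ M N)))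
    (free_lift (fun p => b p.1 p.2)) (@qpi_surj _ _ _).
  move=> x /qpi0/asboolP/(_ (ker_pred (free_lift (fun p => b p.1 p.2)))) H.
  apply/eqP/H => _ [m m' n|m n n'|a m n|a m n]; rewrite unfold_in; apply/eqP;
    rewrite ?linearB ?linearZ /= !free_liftU /=.
  - by rewrite -[m]scale1r br !scale1r addrAC addrK subrr.
  - by rewrite -[n]scale1r bl !scale1r addrAC addrK subrr.
  - rewrite -[X in b X n]addr0 br.
    have -> : b 0 n = 0 by apply: (linear0 (mklin (br n))).
    by rewrite addr0 scalerN subrr.
  - rewrite -[X in b m X]addr0 bl.
    have -> : b m 0 = 0 by apply: (linear0 (mklin (bl m))).
    by rewrite addr0 scalerN subrr.
by exists f => m n; rewrite fP /= free_liftU.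
Qed.

Lemma tswap_bilinear M N : bilinear_map (fun m n => tpure n m : tensor N M).
Proof.
split=> [m a x y|n a x y]; first by rewrite tpureDl tpureZl.
by rewrite tpureDr tpureZr.
Qed.

Definition tswap M N : {linear tensor M N -> tensor N M} :=
  projT1 (cid (tensor_lift (tswap_bilinear M N))).

Lemma tswap_pure M N (m : M) (n : N) : tswap M N (tpure m n) = tpure n m.
Proof. exact: (projT2 (cid (tensor_lift (tswap_bilinear M N)))). Qed.

Lemma tswapK M N : cancel (tswap M N) (tswap N M).
Proof.
apply: (@tensor_eq _ _ _ (tswap N M \o tswap M N) idfun) => m n /=.
by rewrite !tswap_pure.
Qed.

Fact tensor_mapl_subproof A B N (f : {linear A -> B}) :
  exists g : {linear tensor A N -> tensor B N},
    forall m n, g (tpure m n) = tpure (f m) n.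
Proof.
by exists (@tensor_map R A B N f) => m n /=; rewrite tensor_map_pure.
Qed.

Definition tensor_mapl A B N (f : {linear A -> B}) :=
  projT1 (cid (tensor_mapl_subproof N f)).

Lemma tensor_mapl_pure A B N (f : {linear A -> B}) m n :
  tensor_mapl N f (tpure m n) = tpure (f m) n.
Proof. exact: (projT2 (cid (tensor_mapl_subproof N f))). Qed.

Lemma tensor_maplE A B N (f : {linear A -> B}) :
  tensor_mapl N f =1 @tensor_map R A B N f.
Proof.
apply: tensor_eq => m n /=.
by rewrite tensor_mapl_pure tensor_map_pure.
Qed.

Fact tensor_mapr_subproof M N N' (g : {linear N -> N'}) :
  exists h : {linear tensor M N -> tensor M N'},
    forall m n, h (tpure m n) = tpure m (g n).
Proof.
exists (tswap N' M \o (tensor_mapl M g \o tswap M N)) => m n.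
by rewrite /= tswap_pure tensor_mapl_pure tswap_pure.
Qed.

Definition tensor_mapr M N N' (g : {linear N -> N'}) :=
  projT1 (cid (tensor_mapr_subproof M g)).

Lemma tensor_mapr_pure M N N' (g : {linear N -> N'}) m n :
  tensor_mapr M g (tpure m n) = tpure m (g n).
Proof. exact: (projT2 (cid (tensor_mapr_subproof M g))). Qed.

Lemma tensor_mapr_swap M N N' (g : {linear N -> N'}) t :
  tswap M N' (tensor_mapr M g t) = tensor_mapl M g (tswap M N t).
Proof.
apply: (@tensor_eq _ _ _ (tswap M N' \o tensor_mapr M g)
  (tensor_mapl M g \o tswap M N)) => m n.
by rewrite /= tensor_mapr_pure !tswap_pure tensor_mapl_pure.
Qed.

Lemma tensor_mapC M M' N N' (f : {linear M -> M'}) (g : {linear N -> N'}) t :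
  tensor_mapl N' f (tensor_mapr M g t) = tensor_mapr M' g (tensor_mapl N f t).
Proof.
apply: (@tensor_eq _ _ _ (tensor_mapl N' f \o tensor_mapr M g)
  (tensor_mapr M' g \o tensor_mapl N f)) => m n.
by rewrite /= tensor_mapr_pure !tensor_mapl_pure tensor_mapr_pure.
Qed.

Definition rexact A B C (f : {linear A -> B}) (g : {linear B -> C}) :=
  surj g /\ forall y, g y = 0 <-> exists x, f x = y.

Lemma tensor_mapl_rexact A B C N (f : {linear A -> B}) (g : {linear B -> C}) :
  rexact f g -> rexact (tensor_mapl N f) (tensor_mapl N g).
Proof.
move=> [gs ex]; split.
  apply: tensor_ind => [|x y [u <-] [v <-]|c n].
  - by exists 0; rewrite linear0.
  - by exists (u + v); rewrite linearD.
  - by have [b <-] := gs c; exists (tpure b n); rewrite tensor_mapl_pure.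
move=> t; split=> [t0|[x <-]]; last first.
  have gf a : g (f a) = 0 by apply/ex; exists a.
  apply: (@tensor_eq _ _ _ (tensor_mapl N g \o tensor_mapl N f) \0) => m n /=.
  by rewrite !tensor_mapl_pure gf tpure0l.
have [s sP] := choice gs.
pose q := cokpi (tensor_mapl N f).
have qE x y n : g x = g y -> q (tpure x n) = q (tpure y n).
  move=> e; have /ex[a aP] : g (x - y) = 0 by rewrite linearB e subrr.
  apply/eqP; rewrite -subr_eq0 -linearB; apply/eqP/cokpi0.
  exists (tpure a n); rewrite tensor_mapl_pure aP.
  by rewrite -[- y]scaleN1r tpureDl tpureZl scaleN1r.
have bb : bilinear_map (fun c n => q (tpure (s c) n)).
  split=> [c a x y|n a x y]; first by rewrite tpureDr tpureZr linearP.
  rewrite -linearP -tpureZl -tpureDl; apply: qE.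
  by rewrite linearP !sP.
have [h hP] := tensor_lift bb.
apply/cokpi0; rewrite -[LHS]/(q t) -(linear0 h) -t0.
apply: (@tensor_eq _ _ _ q (h \o tensor_mapl N g)) => m n /=.
by rewrite tensor_mapl_pure hP; apply: qE; rewrite sP.
Qed.

Lemma tensor_mapr_rexact A B C M (f : {linear A -> B}) (g : {linear B -> C}) :
  rexact f g -> rexact (tensor_mapr M f) (tensor_mapr M g).
Proof.
move=> /(tensor_mapl_rexact M)[gs ex]; split=> [t|t].
  have [x xP] := gs (tswap M C t); exists (tswap B M x).
  by apply: (can_inj (@tswapK M C)); rewrite tensor_mapr_swap tswapK.
have -> : tensor_mapr M g t = 0 <-> tensor_mapl M g (tswap M B t) = 0.
  rewrite -tensor_mapr_swap; split=> [->|e]; first by rewrite linear0.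
  by apply: (can_inj (@tswapK M C)); rewrite e linear0.
rewrite ex; split=> -[x xP].
  exists (tswap A M x); apply: (can_inj (@tswapK M B)).
  by rewrite tensor_mapr_swap tswapK.
by exists (tswap M A x); rewrite -tensor_mapr_swap xP.
Qed.

Lemma tensor_mapr_comp A B C M (f : {linear A -> B}) (g : {linear B -> C}) t :
  tensor_mapr M g (tensor_mapr M f t) = tensor_mapr M (g \o f) t.
Proof.
apply: (@tensor_eq _ _ _ (tensor_mapr M g \o tensor_mapr M f)
  (tensor_mapr M (g \o f))) => m n.
by rewrite /= !tensor_mapr_pure.
Qed.

Lemma tensor_unit_bilinear M : bilinear_map (fun (m : M) (r : R^o) => r *: m).
Proof.
split=> [m a x y|n a x y]; first by rewrite scalerDl scalerA.
by rewrite scalerDr !scalerA mulrC.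
Qed.

Definition tensor_unit M : {linear tensor M R^o -> M} :=
  projT1 (cid (tensor_lift (@tensor_unit_bilinear M))).

Lemma tensor_unit_pure M m (r : R^o) : tensor_unit M (tpure m r) = r *: m.
Proof. exact: (projT2 (cid (tensor_lift (@tensor_unit_bilinear M)))). Qed.

Fact tensor_pure1_linear M : linear (fun m : M => tpure m (1 : R^o)).
Proof. by move=> a x y; rewrite tpureDl tpureZl. Qed.

Lemma tensor_unitK M (t : tensor M R^o) : tpure (tensor_unit M t) (1 : R^o) = t.
Proof.
apply: (@tensor_eq _ _ _ (mklin (@tensor_pure1_linear M) \o tensor_unit M)
  idfun) => m n /=.
by rewrite tensor_unit_pure tpureZl -tpureZr /GRing.scale /= mulr1.
Qed.

Lemma tensor_mapr_sum M V W n (u : 'I_n -> {linear V -> W})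
    (v : 'I_n -> {linear W -> V}) a :
  (forall x, \sum_i v i (u i x) = a *: x) ->
  forall t, \sum_i tensor_mapr M (v i) (tensor_mapr M (u i) t) = a *: t.
Proof.
move=> uv; have lf : linear (fun t : tensor M V =>
    \sum_i tensor_mapr M (v i) (tensor_mapr M (u i) t)).
  move=> b x y; rewrite scaler_sumr -big_split; apply: eq_bigr => i _.
  by rewrite !linearP.
apply: (@tensor_eq _ _ _ (mklin lf) (a \*: idfun)) => m x /=.
rewrite -tpureZr -uv tpure_sumr; apply: eq_bigr => i _.
by rewrite !tensor_mapr_pure.
Qed.

Section Ssum.
Variables (S : R -> Prop).

Lemma ssum_tensor M V W : ssum S V W -> ssum S (tensor M V) (tensor M W).
Proof.
move=> [n [u [v [a [Sa uv]]]]].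
exists n, (fun i => tensor_mapr M (u i)), (fun i => tensor_mapr M (v i)), a.
by split=> // t; exact: tensor_mapr_sum.
Qed.

Lemma ssum_tensor_unit M : S 1 -> ssum S (tensor M R^o) M.
Proof.
move=> S1; exists 1%N, (fun=> tensor_unit M).
exists (fun=> mklin (@tensor_pure1_linear M)), 1.
by split=> // t; rewrite big_ord1 /= tensor_unitK scale1r.
Qed.

Lemma ssum_trans U V W : mult_set S -> ssum S U V -> ssum S V W -> ssum S U W.
Proof.
move=> mS [n [u [v [a [Sa uv]]]]] [m [u' [v' [b [Sb uv']]]]].
pose e (k : 'I_#|{: 'I_n * 'I_m}|) := enum_val k.
exists #|{: 'I_n * 'I_m}|, (fun k => u' (e k).2 \o u (e k).1).
exists (fun k => v (e k).1 \o v' (e k).2), (a * b).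
split=> [|x]; first exact: mS.2.
rewrite -(reindex (op := +%R) (@enum_val _ {: 'I_n * 'I_m})
  (F := fun k => v k.1 (v' k.2 (u' k.2 (u k.1 x)))) (P := predT)) /=; last first.
  by apply: onW_bij; exact: enum_val_bij.
rewrite -(pair_bigA _ (fun i j => v i (v' j (u' j (u i x))))) /=.
rewrite mulrC -scalerA -uv scaler_sumr; apply: eq_bigr => i _.
by rewrite -linear_sum uv' linearZ.
Qed.

End Ssum.

Lemma free_flat (X : choiceType) A B (f : {linear A -> B}) :
  injective f -> injective (tensor_mapr (malg X R) f).
Proof.
move=> fi.
have cl (x : X) : linear (mcoeff x : malg X R -> R^o).
  by move=> a u v; rewrite mcoeffD mcoeffZ.
have [c cE] : exists c : forall (x : X) V, {linear tensor (malg X R) V -> V},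
    forall x V u v, c x V (tpure u v) = mcoeff x u *: v.
  exists (fun x V =>
    tensor_unit V \o (tswap _ _ \o tensor_mapl V (mklin (cl x)))).
  by move=> x V u v; rewrite /= tensor_mapl_pure tswap_pure tensor_unit_pure.
pose D V (d : {fset X}) (t : tensor (malg X R) V) :=
  t = \sum_(x <- d) tpure (mkmalgU x 1) (c x V t).
have tD V t : exists d : {fset X}, forall d', (d `<=` d')%fset -> @D V d' t.
  move: t; apply: tensor_ind => [|s t [d dP] [e eP]|u v].
  - exists fset0 => d' _; rewrite /D big1 // => x _.
    by rewrite linear0 tpure0r.
  - exists (d `|` e)%fset => d'; rewrite fsubUset => /andP[/dP ds /eP et].
    rewrite /D {1}ds {1}et -big_split; apply: eq_bigr => x _.
    by rewrite linearD tpureDr.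
  - exists (msupp u) => d' ud; rewrite /D {1}(monalgEw ud).
    rewrite tpure_suml; apply: eq_bigr => x _.
    by rewrite cE tpureZr -tpureZl -mkmalgU_scale.
have cf x t : c x B (tensor_mapr _ f t) = f (c x A t).
  apply: (@tensor_eq _ _ _ (c x B \o tensor_mapr _ f) (f \o c x A)) => m n.
  by rewrite /= tensor_mapr_pure !cE linearZ.
apply/lin_inj => t t0; have [d /(_ d (fsubset_refl _)) ->] := tD A t.
rewrite big1 // => x _; have -> : c x A t = 0.
  by apply: fi; rewrite -cf t0 !linear0.
exact: tpure0r.
Qed.

End Tensor.

(** * Tor-acyclicity *)

Section TorIndependence.
Variable R : comNzRingType.
Implicit Types A B C U V W : lmodType R.

Fact kinc_linear U V (f : {linear U -> V}) : linear (val : ker f -> U).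
Proof. by []. Qed.

Definition kinc U V (f : {linear U -> V}) : {linear ker f -> U} :=
  mklin (@kinc_linear U V f).

Lemma kincP U V (f : {linear U -> V}) x : f x = 0 <-> exists y, kinc f y = x.
Proof.
split=> [fx|[y <-]]; last by apply/eqP; exact: valP y.
have xk : x \in ker_pred f by rewrite unfold_in fx.
by exists (Sub x xk).
Qed.

Lemma kinc_inj U V (f : {linear U -> V}) : injective (kinc f).
Proof. exact: val_inj. Qed.

Lemma ses_ker U V (f : {linear U -> V}) : surj f -> ses (kinc f) f.
Proof.
by move=> fs; split=> [||y]; [exact: kinc_inj|exact: fs|exact: kincP].
Qed.

Lemma ses_rexact A B C (f : {linear A -> B}) (g : {linear B -> C}) :
  ses f g -> rexact f g.
Proof. by case. Qed.

Lemma homology0 A B C (f : {linear A -> B}) (g : {linear B -> C}) :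
  ~ nonzero_module (homology f g) <->
  forall y, g y = 0 -> exists x, f x = y.
Proof.
split=> [h0 y /kincP[z zy]|ex].
  have : qpi (bnd_pred f (g := g)) z = 0.
    by apply/eqP; apply: contrapT => /negP z0; apply: h0; exists (qpi _ z).
  by move/qpi0/asboolP => [x fx]; exists x; rewrite fx -zy.
move=> [v /eqP]; apply; rewrite -[v]qpi_repr; apply/qpi0/asboolP/ex.
exact/kincP/ex_intro.
Qed.

Variable M : lmodType R.

(* [Tor_1 (syz M k) V = 0] for all [k], which is [Tor_i M V = 0] for all [i > 0]
   by dimension shifting. *)
Definition Tor_acyclic V := forall k,
  injective (tensor_mapl V (kinc (free_cover (syz M k)))).

Lemma syz_rexact k :
  rexact (kinc (free_cover (syz M k))) (free_cover (syz M k)).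
Proof. exact/ses_rexact/ses_ker/free_cover_surj. Qed.

Lemma Tor_acyclic_inj A B C (f : {linear A -> B}) (g : {linear B -> C}) k :
  ses f g -> Tor_acyclic C -> injective (tensor_mapr (syz M k) f).
Proof.
move=> fg TC; apply/lin_inj => a a0; have [fi _ _] := fg.
have [As Aex] := tensor_mapl_rexact A (syz_rexact k).
have [Bs Bex] := tensor_mapl_rexact B (syz_rexact k).
have [a' a'P] := As a; rewrite -a'P -tensor_mapC in a0.
have /Bex[b bP] := a0.
have [_ ex] := tensor_mapr_rexact (syz M k.+1) (ses_rexact fg).
have /ex[c cP] : tensor_mapr (syz M k.+1) g b = 0.
  apply: (TC k); rewrite linear0 tensor_mapC bP tensor_mapr_comp.
  have [_ ex'] := tensor_mapr_rexact (fres M k) (ses_rexact fg).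
  by rewrite -tensor_mapr_comp; apply/ex'; exists a'.
rewrite -a'P; apply/Aex; exists c.
apply: (@free_flat _ _ _ _ f fi); rewrite -bP -cP; exact/esym/tensor_mapC.
Qed.

Lemma tensor_ses A B C (f : {linear A -> B}) (g : {linear B -> C}) :
  ses f g -> Tor_acyclic C -> ses (tensor_mapr M f) (tensor_mapr M g).
Proof.
move=> fg TC; have [gs ex] := tensor_mapr_rexact M (ses_rexact fg).
by split=> //; exact: (@Tor_acyclic_inj _ _ _ f g 0).
Qed.

Lemma Tor_acyclic_left A B C (f : {linear A -> B}) (g : {linear B -> C}) :
  ses f g -> Tor_acyclic B -> Tor_acyclic C -> Tor_acyclic A.
Proof.
move=> fg TB TC k; apply/lin_inj => a a0.
apply: (Tor_acyclic_inj (k := k.+1) fg TC); rewrite linear0.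
by apply: (TB k); rewrite tensor_mapC a0 !linear0.
Qed.

Lemma tensor_unit_natural U V (f : {linear U -> V}) t :
  tensor_unit V (tensor_mapl R^o f t) = f (tensor_unit U t).
Proof.
apply: (@tensor_eq _ _ _ _ (tensor_unit V \o tensor_mapl R^o f)
  (f \o tensor_unit U)) => m n.
by rewrite /= tensor_mapl_pure !tensor_unit_pure linearZ.
Qed.

Lemma Tor_acyclic_unit : Tor_acyclic R^o.
Proof.
move=> k; apply/lin_inj => t t0; rewrite -[t]tensor_unitK.
have -> : tensor_unit _ t = 0.
  by apply: kinc_inj; rewrite -tensor_unit_natural t0 !linear0.
exact: tpure0l.
Qed.

Lemma Tor_acyclic_ssum V W : ssum (eq 1) V W -> Tor_acyclic W -> Tor_acyclic V.
Proof.
move=> [n [u [v [_ [<- uv]]]]] TW k; apply/lin_inj => t t0.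
rewrite -[t]scale1r -(tensor_mapr_sum uv).
rewrite big1 // => j _; 
have -> : tensor_mapr _ (u j) t = 0; last exact: linear0.
by apply: (TW k); rewrite tensor_mapC t0 !linear0.
Qed.

Lemma tensor_trivial U V :
  (forall x : V, x = 0) -> forall t : tensor U V, t = 0.
Proof.
move=> V0; apply: tensor_ind => // [x y -> ->|m n]; first by rewrite addr0.
by rewrite (V0 n) tpure0r.
Qed.

Lemma Tor_acyclic0 V : (forall x : V, x = 0) -> Tor_acyclic V.
Proof.
by move=> V0 k x y _; rewrite (tensor_trivial V0 x) (tensor_trivial V0 y).
Qed.

Lemma Tor_acyclicP V :
  (forall i, ~ nonzero_module (Tor i.+1 M V)) -> Tor_acyclic V.
Proof.
move=> T0 k; apply/lin_inj => y y0.
have [cs _] := tensor_mapl_rexact V (syz_rexact k.+1).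
have [x xP] := cs y.
pose cov n := free_cover (syz M n).
have dE n t : @tensor_map _ _ _ V (@fres_d R M n) t =
    tensor_mapl V (kinc (cov n)) (tensor_mapl V (cov n.+1) t).
  rewrite -tensor_maplE.
  apply: (@tensor_eq _ _ _ _ (tensor_mapl V (@fres_d R M n))
    (tensor_mapl V (kinc (cov n)) \o tensor_mapl V (cov n.+1))) => m v.
  by rewrite [RHS]/= !tensor_mapl_pure.
have /homology0 ex := T0 k.
have /ex[z zP] : @tensor_map _ _ _ V (@fres_d R M k) x = 0 by rewrite dE xP.
rewrite -xP (etrans (esym zP) (dE k.+1 z)).
have [_ ex'] := tensor_mapl_rexact V (syz_rexact k.+1).
by apply/ex'; exists (tensor_mapl V (free_cover (syz M k.+2)) z).
Qed.

Section TensorCut.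
Variables (r : nat) (D H : nat -> lmodType R) (W : lmodType R).
Variable K : cut_complex r D H W.
Hypothesis TD : forall j, (j < r)%N -> Tor_acyclic (D j).
Hypothesis TH : forall j, (j <= r)%N -> Tor_acyclic (H j).

Lemma Tor_acyclic_bnd j : (j <= r)%N -> Tor_acyclic (bnd K j).
Proof.
elim: j => [|j IH] jr; first exact/Tor_acyclic0/(bnd0 (c := K)).
apply: (Tor_acyclic_left (ses_hom K jr)); last exact/TH/ltnW.
exact: (Tor_acyclic_left (ses_cyc K jr) (TD jr) (IH (ltnW jr))).
Qed.

Definition tensor_cut : cut_complex r (fun j => tensor M (D j))
  (fun j => tensor M (H j)) (tensor M W).
Proof.
apply: (@CutComplex _ _ _ _ _
 (fun j => tensor M (cyc K j)) (fun j => tensor M (bnd K j))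
 (fun j => tensor_mapr M (cinc K j)) (fun j => tensor_mapr M (bpi K j))
 (fun j => tensor_mapr M (binc K j)) (fun j => tensor_mapr M (hpi K j))
 (tensor_mapr M (hinc K)) (tensor_mapr M (wpi K))).
- exact/tensor_trivial/(bnd0 (c := K)).
- move=> j jr; apply: tensor_ses (ses_cyc K jr) _; exact/Tor_acyclic_bnd/ltnW.
- move=> j jr; apply: tensor_ses (ses_hom K jr) _; exact/TH/ltnW.
- apply: tensor_ses (ses_top K) _; exact/Tor_acyclic_bnd.
Defined.

End TensorCut.
End TorIndependence.

(** * Splitting at a prime *)

Section Dichotomy.
Variable R : comNzRingType.

Lemma det_mulmx_gt n m (A : 'M[R]_(n + m.+1, n)) (B : 'M[R]_(n, n + m.+1)) :
  \det (A *m B) = 0.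
Proof.
have -> : A *m B = row_mx A (0 : 'M_(_, m.+1)) *m col_mx B (0 : 'M_(m.+1, _)).
  by rewrite mul_row_col mul0mx addr0.
rewrite det_mulmx (expand_det_col _ (rshift n ord0)) big1 ?mul0r // => i _.
by rewrite row_mxEr mxE mul0r.
Qed.

Variable p : prime_idealr R.

Lemma notin_primeM a b : a \notin p -> b \notin p -> a * b \notin p.
Proof. by move=> ap bp; rewrite prime_idealrM negb_or ap. Qed.

Lemma pcompl_mult : mult_set (fun s => s \notin p).
Proof. by split=> [|a b]; [rewrite idealr1|exact: notin_primeM]. Qed.

Lemma notin_prime_prod I (r : seq I) (P : pred I) (F : I -> R) :
  (forall i, P i -> F i \notin p) -> \prod_(i <- r | P i) F i \notin p.
Proof.
move=> Fp; apply: (big_ind (fun x => x \notin p)) => //; first by rewrite idealr1.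
exact: notin_primeM.
Qed.

Lemma notin_prime_sub a b : a \notin p -> b \in p -> a - b \notin p.
Proof. by move=> ap bp; apply: contra ap => abp; rewrite -[a](subrK b) rpredD. Qed.

Lemma notin_prime_det n c (Y : 'M[R]_n) :
  c \notin p -> (forall i j, Y i j \in p) -> \det (c%:M - Y) \notin p.
Proof.
move=> cp Yp; rewrite /determinant (bigD1 (1%g : 'S_n)) //= -[X in _ + X]opprK.
apply: notin_prime_sub.
  rewrite odd_perm1 expr0 mul1r; apply: notin_prime_prod => i _.
  by rewrite !mxE perm1 eqxx mulr1n notin_prime_sub.
rewrite rpredN; apply: rpred_sum => s s1; apply: idealMr.
have [i si] : exists i, s i != i.
  apply/existsP; apply: contraR s1 => /existsPn H; apply/eqP/permP => i.
  by rewrite perm1; apply/eqP; rewrite -[_ == _]negbK H.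
rewrite (bigD1 i) //= mulrC; apply: idealMr.
by rewrite !mxE eq_sym (negPf si) sub0r rpredN.
Qed.

(* The bordered minor is, up to the factor [\det G], a Schur complement. *)
Lemma bordered_minor k (G : 'M[R]_k) (c : 'cV_k) (r : 'rV_k) (q : R) :
  \det G \notin p -> \det (block_mx G c r q%:M) \in p ->
  q * \det G - (r *m \adj G *m c) 0 0 \in p.
Proof.
set w := (X in _ -> _ -> X \in p) => Gp bp.
have wE : q%:M *m (\det G)%:M - r *m \adj G *m c = w%:M.
  rewrite [r *m \adj G *m c]mx11_scalar -scalar_mxM -raddfB /=.
  by congr (_%:M).
have E : block_mx G c r q%:M *m block_mx 1%:M (- (\adj G *m c)) 0 (\det G)%:M
    = block_mx G 0 r w%:M.
  rewrite mulmx_block !mulmx1 !mulmx0 !addr0 !mulmxN !mulmxA mul_mx_adj.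
  by rewrite mul_scalar_mx mul_mx_scalar addNr [- _ + _]addrC wE.
have : \det G * w \in p.
  have := congr1 (fun A => \det A) E.
  rewrite det_lblock det_scalar1 => <-.
  by rewrite det_mulmx mulrC idealMr.
by rewrite prime_idealrM (negPf Gp).
Qed.

Variables (Q P : lmodType R) (f : {linear Q -> P}).

Let minor k (x : 'I_k -> Q) (psi : 'I_k -> {linear P -> R^o}) : 'M[R]_k :=
  \matrix_(i, j) psi i (f (x j)).
Let has_minor k := exists x psi, \det (@minor k x psi) \notin p.

(* Take a minor of [f] outside [p] of maximal size: inverting it up to its
   determinant gives [e1] such that [y = det - e1 f] has all its entries in [p]
   when there is no [x] as in the second alternative, and then [e1 f] is
   invertible up to a factor outside [p]. *)
Lemma split_or_minimal : ssum (fun s => s \notin p) Q R^o ->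
  (exists (e : {linear P -> Q}) a, a \notin p /\ forall x, e (f x) = a *: x) \/
  (exists x (phi : {linear Q -> R^o}), phi x \notin p /\
     forall psi : {linear P -> R^o}, psi (f x) \in p).
Proof.
move=> [n [u [v [a [ap uv]]]]].
pose V i : Q := v i 1.
have uV x : a *: x = \sum_i u i x *: V i.
  by rewrite -uv; apply: eq_bigr => i _; rewrite -linearZ /GRing.scale /= mulr1.
have minor_le k : has_minor k -> (k <= n)%N.
  move=> [x [psi D]]; rewrite leqNgt; apply: contra D => nk.
  have [m e] : exists m, k = (n + m.+1)%N by exists (k - n).-1; lia.
  subst k.
  suff : a ^+ (n + m.+1) * \det (minor x psi) \in p.
    rewrite prime_idealrM => /orP[|//].
    rewrite -[X in a ^+ X]card_ord -prodr_const => H.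
    have := @notin_prime_prod _ (index_enum 'I_(n + m.+1)) predT (fun=> a)
      (fun _ _ => ap).
    by rewrite H.
  rewrite -detZ.
  have -> : a *: minor x psi =
    (\matrix_(i, l) psi i (f (V l))) *m (\matrix_(l, j) u l (x j)).
    apply/matrixP => i j; rewrite !mxE.
    have -> : a * psi i (f (x j)) = psi i (f (a *: x j)) by rewrite !linearZ.
    rewrite uV !linear_sum; apply: eq_bigr => l _.
    by rewrite !linearZ !mxE mulrC.
  by rewrite det_mulmx_gt rpred0.
have ex0 : exists k, `[< has_minor k >].
  exists 0; apply/asboolP.
  exists (fun=> 0), (fun=> \0); by rewrite det_mx00 idealr1.
have [k /asboolP[x [psi Gp]] kmax] :=
  ex_maxnP ex0 (fun k H => minor_le k (asboolW H)).
set G := minor x psi in Gp; set D := \det G in Gp.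
have lin1 : linear (fun q => \sum_j (\sum_i \adj G j i * psi i q) *: x j).
  move=> b y z; rewrite scaler_sumr -big_split; apply: eq_bigr => j _ /=.
  rewrite scalerA -scalerDl mulr_sumr -big_split; congr (_ *: _).
  by apply: eq_bigr => i _; rewrite linearP mulrDr mulrCA.
pose e1 := mklin lin1.
pose y : {linear Q -> Q} := (D \*: idfun) \- (e1 \o f).
have yP z (psi0 : {linear P -> R^o}) : psi0 (f (y z)) \in p.
  pose x' (j : 'I_(k + 1)) := if fintype.split j is inl i then x i else z.
  pose psi' (j : 'I_(k + 1)) :=
    if fintype.split j is inl i then psi i else psi0.
  pose c := \col_i psi i (f z); pose r := \row_j psi0 (f (x j)).
  have : \det (block_mx G c r (psi0 (f z))%:M) \in p.
    have <- : minor x' psi' = block_mx G c r (psi0 (f z))%:M.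
      apply/matrixP => i j; rewrite !mxE /x' /psi'.
      case: (fintype.split i) => i'; rewrite !mxE;
        case: (fintype.split j) => j'; rewrite /G /minor /c /r !mxE //.
      by rewrite (ord1 i') (ord1 j') eqxx.
    apply: contraT => H; have := kmax (k + 1)%N; rewrite addn1 ltnn => -> //.
    by apply/asboolP; rewrite -addn1; exists x', psi'.
  move/(bordered_minor Gp).
  suff -> : psi0 (f (y z)) = psi0 (f z) * D - (r *m \adj G *m c) 0 0 by [].
  rewrite /y /= !linearB !linearZ /= mulrC; congr (_ - _).
  rewrite !linear_sum -mulmxA mxE; apply: eq_bigr => j _.
  rewrite !linearZ !mxE mulrC; congr (_ * _); apply: eq_bigr => i _.
  by rewrite !mxE.
have [alt|nalt] := pselect (exists x (phi : {linear Q -> R^o}),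
  phi x \notin p /\ forall psi : {linear P -> R^o}, psi (f x) \in p).
  by right.
left.
have yQ z (phi : {linear Q -> R^o}) : phi (y z) \in p.
  apply: contraT => H; case: nalt; by exists (y z), phi.
pose Y := \matrix_(i, l) u i (y (V l)).
pose U z : 'cV[R]_n := \col_i u i z.
pose A := (a * D)%:M - Y.
have UT z : a *: U (e1 (f z)) = A *m U z.
  apply/matrixP => i j; rewrite mulmxBl mul_scalar_mx !mxE.
  have -> : e1 (f z) = D *: z - y z by rewrite /y /= opprB addrC subrK.
  rewrite linearB linearZ mulrBr mulrA; congr (_ - _).
  have -> : a * u i (y z) = u i (y (a *: z)) by rewrite !linearZ.
  rewrite uV !linear_sum; apply: eq_bigr => l _.
  by rewrite !linearZ !mxE mulrC.
have lin2 : linear (fun z => \sum_l (\sum_i \adj A l i * (a * u i z)) *: V l).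
  move=> b w z; rewrite scaler_sumr -big_split; apply: eq_bigr => j _ /=.
  rewrite scalerA -scalerDl mulr_sumr -big_split; congr (_ *: _).
  apply: eq_bigr => i _; rewrite linearP !mulrDr; congr (_ + _).
  by rewrite /GRing.scale /=; ring.
exists (mklin lin2 \o e1), (\det A * a); split.
  apply: notin_primeM => //; apply: notin_prime_det; first exact: notin_primeM.
  by move=> i j; rewrite mxE.
move=> z; rewrite -scalerA uV scaler_sumr /=; apply: eq_bigr => l _.
rewrite scalerA; congr (_ *: _).
have := congr1 (fun B : 'cV_n => B l 0) (congr1 (mulmx (\adj A)) (UT z)).
rewrite mulmxA mul_adj_mx mul_scalar_mx !mxE => <-.
by apply: eq_bigr => i _; rewrite !mxE.
Qed.

End Dichotomy.

(** * Associated primes and supports *)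

Section Noetherian.
Variable R : comNzRingType.

Definition is_ideal (A : R -> Prop) :=
  A 0 /\ forall a x y, A x -> A y -> A (a * x + y).

Section IdealModule.
Variables (A : R -> Prop) (Ai : is_ideal A).
Definition ideal_pred of is_ideal A : {pred R^o} := fun x => `[< A x >].
Fact ideal_pred_closed : submod_closed (ideal_pred Ai).
Proof.
case: (Ai) => A0 Al.
by split=> [|a x y /asboolP Ax /asboolP Ay]; apply/asboolP => //; exact: Al.
Qed.
HB.instance Definition _ :=
  GRing.isSubmodClosed.Build R R^o (ideal_pred Ai) ideal_pred_closed.
End IdealModule.

Lemma ideal_sum (A : R -> Prop) I (r : seq I) (c g : I -> R) :
  is_ideal A -> (forall i, A (g i)) -> A (\sum_(i <- r) c i * g i).
Proof.
move=> [A0 Al] Ag; elim: r => [|i r IH]; first by rewrite big_nil.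
by rewrite big_cons; apply: Al.
Qed.

Lemma noetherian_gens (A : R -> Prop) : noetherian_ring R -> is_ideal A ->
  exists n (g : 'I_n -> R), (forall i, A (g i)) /\
    forall x, A x -> exists c : 'I_n -> R, x = \sum_i c i * g i.
Proof.
move=> noeth Ai; have [n [g gP]] := noeth (ideal_pred Ai).
exists n, (fun i => val (g i)).
split=> [i|x Ax]; first exact/asboolP/(valP (g i)).
have xA : x \in ideal_pred Ai by apply/asboolP.
have vl : linear (val : submod (ideal_pred Ai) -> R^o) by [].
have [c cP] := gP (Sub x xA); exists c.
have := congr1 (mklin vl) cP; rewrite linear_sum /= => ->.
by apply: eq_bigr => i _; rewrite /GRing.scale.
Qed.

Local Open Scope classical_set_scope.

Lemma noetherian_maximal (F : set (set R)) : noetherian_ring R ->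
  (forall A, F A -> is_ideal A) -> F !=set0 ->
  exists A, F A /\ forall B, F B -> A `<=` B -> B = A.
Proof.
move=> noeth Fi [A0 FA0].
pose P : set (set R) := [set A | A = set0 \/ F A].
have [C CP Ctot|A [[->|FA] Amax]] := @Zorn_bigcup R P.
- have [[a0 [A aA aa]]|e] := pselect (exists x, (\bigcup_(X in C) X) x);
    last first.
    left; apply/seteqP; split=> // x Cx; case: e; exists x; exact: Cx.
  have FC X x : C X -> X x -> F X by move=> /CP[->|].
  have Ui : is_ideal (\bigcup_(X in C) X).
    split.
      by exists A => //; case: (Fi _ (FC _ _ aA aa)).
    move=> a x y [X CX Xx] [Y CY Yy].
    have [XY|YX] := Ctot _ _ CX CY.
      exists Y => //; apply: (Fi _ (FC _ _ CY Yy)).2 => //; exact: XY.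
    exists X => //; apply: (Fi _ (FC _ _ CX Xx)).2 => //; exact: YX.
  have [n [g [gU gP]]] := noetherian_gens noeth Ui.
  have [X [CX FX gX]] : exists X, [/\ C X, F X & forall i, X (g i)].
    suff : forall s : seq 'I_n,
        exists X, [/\ C X, F X & forall i, i \in s -> X (g i)].
      move=> /(_ (enum 'I_n))[X [CX FX H]]; exists X; split=> // i.
      by apply: H; rewrite mem_enum.
    elim=> [|i s [X [CX FX Xs]]].
      by exists A; split=> //; exact: FC aA aa.
    have [Y CY Yi] := gU i; have [XY|YX] := Ctot _ _ CX CY.
      exists Y; split=> [//||j]; first exact: FC CY Yi.
      by rewrite inE => /predU1P[->//|/Xs]; exact: XY.
    by exists X; split=> // j; rewrite inE => /predU1P[->|/Xs//]; exact: YX.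
  right; have -> : \bigcup_(X in C) X = X; last by [].
  apply/seteqP; split=> [x /gP[c ->]|x Xx]; last by exists X.
  by apply: ideal_sum => //; exact: Fi.
- exfalso; apply: (Amax A0); last by right.
  by split=> // /(_ 0 (Fi _ FA0).1).
- exists A; split=> // B FB AB; apply: contrapT => BA.
  apply: (Amax B); last by right.
  by split=> // BA'; apply: BA; apply/seteqP.
Qed.

End Noetherian.

Section AssociatedPrime.
Variables (R : comNzRingType) (A : R -> Prop).
Hypotheses (Ai : is_ideal A) (A1 : ~ A 1).
Hypothesis Ap : forall a b, A (a * b) -> A a \/ A b.

Definition prime_pred of is_ideal A & ~ A 1 &
  (forall a b, A (a * b) -> A a \/ A b) : pred R := fun x => `[< A x >].

Fact prime_pred_idealr : idealr_closed (prime_pred Ai A1 Ap).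
Proof.
case: (Ai) => A0 Al; split=> [||a x y /asboolP Ax /asboolP Ay].
- exact/asboolP.
- by apply/negP => /asboolP.
- by apply/asboolP/Al.
Qed.

Fact prime_pred_prime : prime_idealr_closed (prime_pred Ai A1 Ap).
Proof.
by move=> u v /asboolP/Ap[] H; apply/orP; [left|right]; apply/asboolP.
Qed.

HB.instance Definition _ :=
  isIdealr.Build R (prime_pred Ai A1 Ap) prime_pred_idealr.
HB.instance Definition _ :=
  isPrimeIdealrClosed.Build R (prime_pred Ai A1 Ap) prime_pred_prime.

Lemma prime_idealr_of : exists p : prime_idealr R, forall x, x \in p <-> A x.
Proof.
by exists (prime_pred Ai A1 Ap) => x; split=> [/asboolP|?]; last exact/asboolP.
Qed.

End AssociatedPrime.

Section Support.
Variable R : comNzRingType.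
Implicit Types V L : lmodType R.

Lemma associated_prime V : noetherian_ring R -> nonzero_module V ->
  exists (v : V) (p : prime_idealr R), forall a, a \in p <-> a *: v = 0.
Proof.
move=> noeth [v0 v00].
pose ann (v : V) : set R := fun a => a *: v = 0.
have anni v : is_ideal (ann v).
  split=> [|a x y xv yv]; first exact: scale0r.
  by rewrite /ann scalerDl -scalerA xv yv scaler0 addr0.
have [||_ [[v [vn0 ->]] vmax]] :=
  @noetherian_maximal R (fun A => exists v, v != 0 /\ A = ann v) noeth.
- by move=> _ [v [_ ->]].
- by exists (ann v0), v0.
have v1 : ~ ann v 1 by rewrite /ann scale1r => /eqP; apply/negP.
have vp a b : ann v (a * b) -> ann v a \/ ann v b.
  move=> abv; have [av|/eqP av] := eqVneq (a *: v) 0; [by left|right].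
  have <- : ann (a *: v) = ann v.
    apply: vmax; first by exists (a *: v); split=> //; exact/eqP.
    by move=> c cv; rewrite /ann scalerA mulrC -scalerA cv scaler0.
  by rewrite /ann scalerA mulrC.
by have [p pP] := prime_idealr_of (anni v) v1 vp; exists v, p.
Qed.

Lemma in_suppP V (p : prime_idealr R) :
  in_supp V p <-> exists v : V, forall s, s \notin p -> s *: v <> 0.
Proof.
split=> [[f f0]|[v vP]].
  exists (repr f).1 => s sp sv; move/negP: f0; apply; apply/eqP.
  rewrite -[f]frac_repr; apply/eq_frac; exists (exist _ s sp) => /=.
  by rewrite scaler0 mulr1.
exists (lfrac v (pcompl1 p)); apply/eqP => /eq_frac[[u up]] /=.
by rewrite mulr1 scaler0; exact: vP.
Qed.

Lemma supp_annihilator V (p : prime_idealr R) : fin_gen V ->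
  (forall s, (forall v : V, s *: v = 0) -> s \in p) -> in_supp V p.
Proof.
move=> [n [g gP]] Hp; apply/in_suppP; apply: contrapT => H.
have /choice[s sP] v : exists s, s \notin p /\ s *: (v : V) = 0.
  apply: contrapT => Hv; apply: H; exists v => s sp sv.
  by apply: Hv; exists s.
have := @notin_prime_prod R p _ (index_enum 'I_n) predT (fun i => s (g i)).
rewrite Hp => [/(_ (fun i _ => (sP (g i)).1))//|v].
have [c ->] := gP v; rewrite scaler_sumr big1 // => i _.
rewrite scalerA [_ * c i]mulrC -scalerA (bigD1 i) //=.
by rewrite [s _ * _]mulrC -scalerA (sP _).2 !scaler0.
Qed.

End Support.

(** * Ext by cocycles *)

Section ExtCocycles.
Variable R : comNzRingType.
Implicit Types L A B C U V : lmodType R.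

(* The standard free resolution shifted by one degree and completed by [0], so
   that [Ext^i] is the cohomology at [i + 1] for every [i], [i = 0] included. *)
Definition sres L (n : nat) : lmodType R :=
  if n is n'.+1 then fres L n' else malg void R.

Definition sres_d L n : {linear sres L n.+1 -> sres L n} :=
  match n return {linear sres L n.+1 -> sres L n} with
  | 0 => \0
  | n'.+1 => @fres_d R L n'
  end.

Lemma sres_dd L n x : sres_d L n (sres_d L n.+1 x) = 0.
Proof. by case: n x => [//|n] x /=; apply/fres_exact; exists x. Qed.

Lemma sres_projective L n : projective (sres L n).
Proof. by case: n => [|n]; exact: free_projective. Qed.

Lemma sres0 L (x : sres L 0) : x = 0.
Proof. by apply/malgP => -[]. Qed.

Lemma homology_repr A B C (f : {linear A -> B}) (g : {linear B -> C})
    (e : homology f g) :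
  exists y, g y = 0 /\ forall a, a *: e = 0 <-> exists x, f x = a *: y.
Proof.
exists (val (repr e)); split=> [|a]; first exact/kincP/(ex_intro _ (repr e)).
rewrite -{1}[e]qpi_repr -linearZ.
have -> : (qpi (bnd_pred f (g := g)) (a *: repr e) = 0) <->
    (a *: repr e \in bnd_pred f (g := g)) by exact: qpi0.
by split=> [/asboolP//|H]; exact/asboolP.
Qed.

Definition hom_of U V (f : {linear U -> V}) : hom U V :=
  exist (fun h => h \in hom_pred (V := V)) (f : U -> V)
    (introT (asboolP _) (linearP f)).

Lemma hom_lin U V (h : hom U V) : linear (val h).
Proof. exact: (asboolP _ (valP h)). Qed.

Lemma Ext_repr i L A (e : Ext i L A) :
  exists z : {linear sres L i.+1 -> A}, cocycle (sres_d L) z /\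
    forall a, a *: e = 0 <->
      exists w : {linear sres L i -> A}, forall x, a *: z x = w (sres_d L i x).
Proof.
case: i e => [|i] e; have [y [y0 yP]] := homology_repr e;
  exists (mklin (hom_lin y)); split.
- by move=> x; exact: (congr1 (fun h : hom _ _ => val h x) y0).
- move=> a; rewrite yP; split=> [[x xP]|[w wP]].
    exists \0 => u.
    exact: (esym (congr1 (fun h : hom _ _ => val h u) xP)).
  exists 0; apply/val_inj/funext => u /=.
  by rewrite -[RHS]/(a *: mklin (hom_lin y) u) wP linear0.
- by move=> x; exact: (congr1 (fun h : hom _ _ => val h x) y0).
- move=> a; rewrite yP; split=> [[x xP]|[w wP]].
    exists (mklin (hom_lin x)) => u.
    exact: (esym (congr1 (fun h : hom _ _ => val h u) xP)).
  by exists (hom_of w); apply/val_inj/funext => u /=; rewrite -wP.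
Qed.

Lemma Ext_vanish i L A :
  ~ nonzero_module (Ext i L A) <-> Enull (eq 1) (sres_d L) i A.
Proof.
split=> [E0 z zd|En [e /eqP e0]]; last first.
  have [z [zd zP]] := Ext_repr e; apply: e0; rewrite -[e]scale1r; apply/zP.
  have [_ [w [<- wP]]] := En z zd; by exists w.
case: i z zd E0 => [|i] z zd /homology0 E0.
  have [|x xP] := E0 (hom_of z); first by apply/val_inj/funext => u; exact: zd.
  exists 1, \0; split=> // u; rewrite scale1r.
  exact: (esym (congr1 (fun h : hom _ _ => val h u) xP)).
have [|x xP] := E0 (hom_of z); first by apply/val_inj/funext => u; exact: zd.
exists 1, (mklin (hom_lin x)); split=> // u; rewrite scale1r.
exact: (esym (congr1 (fun h : hom _ _ => val h u) xP)).
Qed.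

(* Multiplication by [s] is null-homotopic on the resolution of [L]. *)
Lemma ann_Ext L s : (forall v : L, s *: v = 0) -> forall i A
  (z : {linear sres L i.+1 -> A}), cocycle (sres_d L) z ->
  exists w : {linear sres L i -> A}, forall x, s *: z x = w (sres_d L i x).
Proof.
move=> sL.
have hom i (t : {linear syz L i -> fres L i}) :
    (forall x, free_cover (syz L i) (t x) = s *: x) ->
    exists h : {linear fres L i -> syz L i.+1},
      forall x, h (kinc (free_cover (syz L i)) x) = s *: x.
  move=> tP.
  have [|h hP] := @lift_inj _ _ _ _ (kinc (free_cover (syz L i)))
      ((s \*: idfun) \- (t \o free_cover (syz L i))) (@kinc_inj _ _ _ _).
    by move=> x; apply/kincP; rewrite /= linearB linearZ /= tP subrr.
  exists h => x; apply: (@kinc_inj _ _ _ (free_cover (syz L i))).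
  have x0 : free_cover (syz L i) (kinc _ x) = 0 by apply/kincP; exists x.
  by rewrite hP [LHS]/= x0 linear0 subr0 linearZ.
have theta i : exists t : {linear syz L i -> fres L i},
    forall x, free_cover (syz L i) (t x) = s *: x.
  elim: i => [|i [t /hom[h hP]]]; first by exists \0 => x; rewrite linear0 sL.
  have [h' h'P] := @free_projective _ (syz L i) _ _ (free_cover (syz L i.+1)) h
    (@free_cover_surj _ _).
  by exists (h' \o kinc (free_cover (syz L i))) => x /=; rewrite h'P hP.
move=> i A z zd.
have [|z' z'P] :=
  @lift_surj _ _ _ _ (free_cover (syz L i)) z (@free_cover_surj _ _).
  move=> x /kincP[y <-]; have [u <-] := @free_cover_surj R (syz L i.+1) y.
  exact: (zd u).
case: i z zd z' z'P => [|i] z zd z' z'P.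
  by exists \0 => x; rewrite -z'P -linearZ (sL _) linear0.
have [t /hom[h hP]] := theta i.
by exists (z' \o h) => x; rewrite -z'P -linearZ -hP.
Qed.

End ExtCocycles.

Section Summands.
Variable R : comNzRingType.
Implicit Types V W N : lmodType R.

Lemma ssum_sub (S S' : R -> Prop) V W :
  (forall a, S a -> S' a) -> ssum S V W -> ssum S' V W.
Proof.
by move=> SS [n [u [v [a [Sa uv]]]]]; exists n, u, v, a; split=> //; exact: SS.
Qed.

Lemma one_mult : mult_set (eq (1 : R)).
Proof. by split=> // a b <- <-; rewrite mulr1. Qed.

Lemma ssum_retract (S : R -> Prop) V W (u : {linear V -> W})
    (v : {linear W -> V}) a :
  S a -> (forall x, v (u x) = a *: x) -> ssum S V W.
Proof.
move=> Sa uv; exists 1%N, (fun=> u), (fun=> v), a.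
by split=> // x; rewrite big_ord1.
Qed.

Lemma fin_gen_projective_ssum V : fin_gen V -> projective V -> ssum (eq 1) V R^o.
Proof.
move=> [n [g gP]] pV.
have lf : linear (fun w : 'rV[R]_n => \sum_i w 0 i *: g i).
  move=> a x y; rewrite scaler_sumr -big_split; apply: eq_bigr => i _ /=.
  by rewrite !mxE scalerDl scalerA.
have [|s sP] := pV _ _ (mklin lf) idfun.
  move=> v; have [c ->] := gP v; exists (\row_i c i) => /=.
  by apply: eq_bigr => i _; rewrite mxE.
have lu i : linear (fun x : V => s x 0 i : R^o).
  by move=> a x y; rewrite linearP !mxE.
have lv i : linear (fun r : R^o => r *: g i).
  by move=> a x y; rewrite scalerDl scalerA.
exists n, (fun i => mklin (lu i)), (fun i => mklin (lv i)), 1; split=> // x.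
by rewrite scale1r; exact: sP.
Qed.

Lemma ffun_ssum N n : ssum (eq 1) {ffun 'I_n -> N} N.
Proof.
have lu (i : 'I_n) : linear (fun f : {ffun 'I_n -> N} => f i).
  by move=> a x y; rewrite !ffunE.
have lv (i : 'I_n) : linear (fun m : N => [ffun j => if j == i then m else 0]).
  move=> a x y; apply/ffunP => j; rewrite !ffunE.
  by case: ifP => // _; rewrite scaler0 addr0.
exists n, (fun i => mklin (lu i)), (fun i => mklin (lv i)), 1; split=> // f.
rewrite scale1r; apply/ffunP => j; rewrite sum_ffunE (bigD1 j) //= big1.
  by rewrite ffunE eqxx addr0.
by move=> i ij; rewrite ffunE eq_sym (negPf ij).
Qed.

Lemma ssum_ffun N n : (0 < n)%N -> ssum (eq 1) N {ffun 'I_n -> N}.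
Proof.
case: n => // n _.
have lu : linear (fun m : N => [ffun _ : 'I_n.+1 => m]).
  by move=> a x y; apply/ffunP => j; rewrite !ffunE.
have lv : linear (fun f : {ffun 'I_n.+1 -> N} => f ord0).
  by move=> a x y; rewrite !ffunE.
apply: (@ssum_retract _ _ _ (mklin lu) (mklin lv) 1) => // x /=.
by rewrite ffunE scale1r.
Qed.

Lemma ssum_killed V W a : ssum (eq 1) V W ->
  (forall y : W, a *: y = 0) -> forall x : V, a *: x = 0.
Proof.
move=> [n [u [v [_ [<- uv]]]]] aW x.
rewrite -[x]scale1r -uv scaler_sumr big1 // => i _.
by rewrite -linearZ aW linear0.
Qed.

Lemma ses_coker V W (f : {linear V -> W}) : injective f -> ses f (cokpi f).
Proof. by move=> fi; split=> //; [exact: qpi_surj|exact: cokpi0]. Qed.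

End Summands.

(** * The two inequalities for a bounded complex *)

Section NatComplex.
Variables (R : comNzRingType) (D E H : nat -> lmodType R).
Variable d : forall j, {linear D j.+1 -> D j}.
(* [e j] is the differential out of [D j], into a copy of [D j.-1]; its only role
   is that [ker (e j)] is the module of cycles also for [j = 0]. *)
Variable e : forall j, {linear D j -> E j}.
Hypothesis ker_e : forall j x, e j.+1 x = 0 <-> d j x = 0.
Hypothesis ed : forall j x, e j (d j x) = 0.
Hypothesis D0 : forall x : D 0, x = 0.
Variable hp : forall j, {linear ker (e j) -> H j}.
Hypothesis hp_surj : forall j, surj (hp j).
Hypothesis hp_ker : forall j z, hp j z = 0 <-> exists x, d j x = kinc (e j) z.

Lemma cut_exists q : exists K : cut_complex q.+1 D H (coker (d q.+1)),
  forall y, cinc K q (binc K q (wpi K (cokpi (d q.+1) y))) = d q y.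
Proof.
pose B j := coker (kinc (e j)).
pose bp j : {linear D j -> B j} := cokpi (kinc (e j)).
have bp0 j x : bp j x = 0 <-> e j x = 0.
  by rewrite cokpi0; split=> /kincP.
have dzE j : exists f : {linear D j.+1 -> ker (e j)},
    forall x, kinc (e j) (f x) = d j x.
  by apply: lift_inj (@kinc_inj _ _ _ _) _ => x; apply/kincP.
pose dz j := projT1 (cid (dzE j)).
have dzP j : forall x, kinc (e j) (dz j x) = d j x := projT2 (cid (dzE j)).
have biE j : exists f : {linear B j.+1 -> ker (e j)},
    forall x, f (bp j.+1 x) = dz j x.
  apply: lift_surj (@qpi_surj _ _ _) _ => x /bp0/ker_e dx.
  by apply: (@kinc_inj _ _ _ (e j)); rewrite dzP dx linear0.
pose bi j := projT1 (cid (biE j)).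
have biP j : forall x, bi j (bp j.+1 x) = dz j x := projT2 (cid (biE j)).
set W := coker (d q.+1).
have [hi hiP] : exists f : {linear H q.+1 -> W},
    forall z, f (hp q.+1 z) = cokpi (d q.+1) (kinc (e q.+1) z).
  apply: (@lift_surj _ _ _ _ (hp q.+1)
    (cokpi (d q.+1) \o kinc (e q.+1)) (@hp_surj _)).
  by move=> z /hp_ker ex; apply/cokpi0.
have [wp wpP] : exists f : {linear W -> B q.+1},
    forall x, f (cokpi (d q.+1) x) = bp q.+1 x.
  apply: lift_surj (@qpi_surj _ _ _) _ => x /cokpi0[y <-].
  by apply/bp0; exact: ed.
have K0 : forall x : B 0, x = 0.
  by move=> x; have [y <-] := @qpi_surj _ _ _ x; rewrite (D0 y) linear0.
have Kc j : (j < q.+1)%N -> ses (kinc (e j)) (bp j).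
  by move=> _; apply: ses_coker; exact: kinc_inj.
have Kh j : (j < q.+1)%N -> ses (bi j) (hp j).
  move=> _; split=> //.
    apply/lin_inj => x; have [y <-] := @qpi_surj _ _ _ x.
    rewrite -[qpi _ y]/(bp j.+1 y) biP => y0; apply/bp0/ker_e.
    by rewrite -dzP y0 linear0.
  move=> z; rewrite hp_ker; split=> -[x xP].
    exists (bp j.+1 x); rewrite biP.
    by apply: (@kinc_inj _ _ _ (e j)); rewrite dzP.
  have [y yx] := @qpi_surj _ _ _ x; exists y.
  by rewrite -xP -yx -[qpi _ y]/(bp j.+1 y) biP dzP.
have Kt : ses hi wp.
  split.
  - apply/lin_inj => h; have [z <-] := @hp_surj _ h.
    by rewrite hiP => /cokpi0 ex; apply/hp_ker.
  - move=> x; have [y <-] := @qpi_surj _ _ _ x.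
    by exists (cokpi _ y); rewrite wpP.
  - move=> x; have [y <-] := @qpi_surj _ _ _ x.
    rewrite -[qpi _ y]/(cokpi (d q.+1) y) wpP; split.
      by move=> /bp0/kincP[z <-]; exists (hp _ z); rewrite hiP.
    move=> [h hy]; have [z zh] := @hp_surj _ h.
    rewrite -wpP -hy -zh hiP wpP; apply/bp0/kincP; by exists z.
exists (CutComplex K0 Kc Kh Kt) => y /=.
by rewrite wpP biP; exact: dzP.
Qed.

Variables (M N : lmodType R) (s t : nat).
Hypothesis DR : forall j, ssum (eq 1) (D j) R^o.
Hypothesis HN : forall j, ssum (eq 1) (H j) N.
Hypothesis NH : ssum (eq 1) N (H s).
Hypothesis Hs : forall j, (s < j)%N -> forall x : H j, x = 0.
Hypothesis Dt : forall j, (t < j)%N -> forall x : D j, x = 0.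
Hypotheses (st : (s <= t)%N) (s0 : (0 < s)%N).

Lemma coker_top_ssum : ssum (eq 1) (coker (d t)) R^o.
Proof.
apply: (ssum_trans (one_mult R) _ (DR t)).
have [|f fP] := @lift_surj _ _ _ _ (cokpi (d t)) idfun (@qpi_surj _ _ _).
  by move=> x /cokpi0[y <-]; rewrite (@Dt t.+1 (leqnn _) y) linear0.
apply: (@ssum_retract _ _ _ _ f (cokpi (d t)) 1) => // x.
have [y <-] := @qpi_surj _ _ _ x.
by rewrite -[qpi _ y]/(cokpi (d t) y) fP scale1r.
Qed.

Hypothesis TN : Tor_acyclic M N.

Let TD j : Tor_acyclic M (D j).
Proof. exact: (Tor_acyclic_ssum (DR j) (@Tor_acyclic_unit _ _)). Qed.

Let TH j : Tor_acyclic M (H j).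
Proof. exact: (Tor_acyclic_ssum (HN j) TN). Qed.

Lemma Evan_tensor (S : R -> Prop) (X : nat -> lmodType R) dX n V :
  mult_set S -> ssum S V R^o -> @Evan R S X dX n M -> Evan S dX n (tensor M V).
Proof.
move=> mS VR; apply: (Evan_ssum mS).
apply: ssum_trans (ssum_tensor M VR) _ => //.
by apply: ssum_tensor_unit; case: mS.
Qed.

Lemma grade_tensor_ub L g h : Evan (eq 1) (sres_d L) g M ->
  Evan (eq 1) (sres_d L) h (tensor M N) -> (h + (t - s) < g)%N ->
  Enull (eq 1) (sres_d L) h (tensor M N).
Proof.
move=> gM hMN hg; have WR := coker_top_ssum.
have [q tE] : exists q, t = q.+1 by exists t.-1; lia.
have sq := st; rewrite tE in sq WR hg; have [K _] := cut_exists q.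
have := @cut_hom_Evan _ _ (one_mult R) _ (sres_d L) (@sres_dd _ L)
  (@sres_projective _ L) (@sres0 _ L) q.+1 s g h _ _ _
  (tensor_cut K (fun j _ => TD (j := j)) (fun j _ => TH (j := j))) sq.
move=> /(_ _ _ _ _ h.+1) Hc.
apply: (Enull_ssum (one_mult R) (W := tensor M (H s))); first exact: ssum_tensor.
apply: Hc => //; last by lia.
- exact: (Evan_tensor (one_mult R) WR gM).
- by move=> j _; exact: (Evan_tensor (one_mult R) (DR j) gM).
- by move=> j _; apply: (Evan_ssum (one_mult R) _ hMN); exact: ssum_tensor.
- by move=> j /andP[sj _]; apply: tensor_trivial; exact: Hs.
Qed.

(* Hence at the lowest cut whose top module is projective up to [S], the top
   differential does not split up to [S]. *)
Lemma split_coker (S : R -> Prop) q (f : {linear coker (d q.+1) -> D q})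
    (g : {linear D q -> coker (d q.+1)}) a :
  mult_set S -> S a -> (forall y, f (cokpi (d q.+1) y) = d q y) ->
  (forall x, g (f x) = a *: x) -> ssum S (coker (d q)) R^o.
Proof.
move=> mS Sa fP gP.
apply: (ssum_trans mS _ (ssum_sub _ (DR q))); last by move=> _ <-; case: mS.
have [|h hP] := @lift_surj _ _ _ _ (cokpi (d q)) ((a \*: idfun) \- (f \o g))
    (@qpi_surj _ _ _).
  by move=> x /cokpi0[y <-] /=; rewrite -fP gP linearZ subrr.
apply: (@ssum_retract _ _ _ _ h (cokpi (d q)) a) => // x.
have [y <-] := @qpi_surj _ _ _ x.
rewrite -[qpi _ y]/(cokpi (d q) y) hP linearB linearZ /=.
have [z <-] := @qpi_surj _ _ _ (g y); rewrite -[qpi _ z]/(cokpi (d q.+1) z) fP.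
have -> : cokpi (d q) (d q z) = 0 by apply/cokpi0; exists z.
by rewrite subr0.
Qed.

Lemma minimal_cut (p : prime_idealr R) (v0 : N) :
  (forall a, a \notin p -> a *: v0 <> 0) ->
  exists q, [/\ (s <= q.+1)%N, ssum (fun a => a \notin p) (coker (d q.+1)) R^o &
    exists K : cut_complex q.+1 D H (coker (d q.+1)),
    exists x (phi : {linear coker (d q.+1) -> R^o}), phi x \notin p /\
      forall psi : {linear D q -> R^o},
        psi (cinc K q (binc K q (wpi K x))) \in p].
Proof.
move=> v0P; have mS := pcompl_mult p; set S := fun a => a \notin p.
pose cut k := (s <= k)%N && `[< ssum S (coker (d k)) R^o >].
have [r /andP[sr /asboolP rS] rmin] : {r | cut r & forall k, cut k -> (r <= k)%N}.
  apply: find_ex_minn; exists t; rewrite /cut st; apply/asboolP.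
  by apply: ssum_sub coker_top_ssum => _ <-; case: mS.
have [q rE] : exists q, r = q.+1 by exists r.-1; lia.
subst r; exists q; split=> //; have [K KP] := cut_exists q; exists K.
pose f := cinc K q \o (binc K q \o wpi K).
have [[g [a [ap gP]]]|//] := split_or_minimal f rS.
exfalso; move: sr; rewrite leq_eqVlt => /orP[/eqP sE|sq]; last first.
  suff /rmin : cut q by rewrite ltnn.
  rewrite /cut -ltnS sq; apply/asboolP.
  exact: (split_coker (f := f) mS ap KP gP).
apply: (v0P _ ap); apply: (ssum_killed NH) => y; rewrite sE in y *.
have [hi _ hex] := ses_top K; apply: hi.
rewrite linear0 linearZ /= -gP /=.
have -> : wpi K (hinc K y) = 0 by apply/hex; exists y.
by rewrite !linear0.
Qed.

Lemma grade_tensor_lb L g h n : noetherian_ring R -> fin_gen L -> supp_sub L N ->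
  Evan (eq 1) (sres_d L) g M -> nonzero_module (Ext g L M) ->
  Evan (eq 1) (sres_d L) h (tensor M N) ->
  Evan (eq 1) (sres_d N) n R^o -> (h + n <= g)%N.
Proof.
move=> noeth fgL LN gM Eg hMN nN.
have [xi [p pP]] := associated_prime noeth Eg.
have [z [zd zP]] := Ext_repr xi.
have zp a : a \in p <-> exists w : {linear sres L g -> M},
  forall u, a *: z u = w (sres_d L g u) by rewrite pP.
have /LN/in_suppP[v0 v0P] : in_supp L p.
  by apply: supp_annihilator => // a aL; apply/zp; exact: ann_Ext.
have mS := pcompl_mult p; set S := fun a => a \notin p.
have S1 a : 1 = a -> S a by move=> <-; case: mS.
have EvanS X dX k V : @Evan R (eq 1) X dX k V -> Evan S dX k V.
  move=> EV i ik u ud; have [b [w [b1 wP]]] := EV i ik u ud.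
  by exists b, w; split=> //; exact: S1.
have [q [sq WR [K [x [phi [phix psix]]]]]] := minimal_cut v0P.
have nq : (n <= q.+1 - s)%N.
  rewrite leqNgt; apply/negP => nlt.
  have E1 : Evan S (sres_d N) 1 (H s).
    apply: (@cut_hom_Evan _ _ mS _ (sres_d N) (@sres_dd _ N)
      (@sres_projective _ N) (@sres0 _ N) q.+1 s n 0 _ _ _ K sq) => //; last by lia.
    - by apply: (Evan_ssum mS WR); exact: EvanS.
    - by move=> j _; apply: (Evan_ssum mS (ssum_sub S1 (DR j))); exact: EvanS.
    - by move=> j /andP[sj _]; exact: Hs.
  have N0 := Enull_ssum mS (ssum_sub S1 NH) (E1 0 isT).
  have [|b [w [Sb wP]]] := N0 (free_cover N : {linear sres N 1 -> N}).
    by move=> u /=; apply/fres_exact0; exists u.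
  have [u uP] := free_cover_surj v0; apply: (v0P _ Sb).
  by rewrite -uP wP (@sres0 _ N (sres_d N 0 u)) linear0.
apply: leq_trans (_ : (h + (q.+1 - s) <= _)%N); first by rewrite leq_add2l.
rewrite leqNgt; apply/negP => glt.
have := @cut_top_Einj _ _ mS _ (sres_d L) (@sres_dd _ L) (@sres_projective _ L)
  (@sres0 _ L) q s g h _ _ _
  (tensor_cut K (fun j _ => TD (j := j)) (fun j _ => TH (j := j))) sq.
move=> /(_ _ _ _ _ glt) Hinj.
have tl : linear (fun u => tpure (z u) x).
  by move=> b y y'; rewrite linearP tpureDl tpureZl.
have [||||||b [w [Sb wP]]] := Hinj _ _ _ _ (mklin tl).
- by apply: (Evan_tensor mS WR); exact: EvanS.
- by move=> j _; apply: (Evan_tensor mS (ssum_sub S1 (DR j))); exact: EvanS.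
- move=> j _; apply: EvanS; apply: (Evan_ssum (one_mult R) _ hMN).
  exact: ssum_tensor.
- by move=> j /andP[sj _]; apply: tensor_trivial; exact: Hs.
- by move=> u /=; rewrite zd tpure0l.
- have [m [u [v [_ [<- uv]]]]] := DR q.
  set y := cinc K q (binc K q (wpi K x)).
  have /choice[w wP] i : exists w : {linear sres L g -> M},
      forall k, u i y *: z k = w (sres_d L g k).
    by apply/zp; exact: psix.
  have lw : linear (fun k => \sum_i tpure (w i k) (v i 1)).
    move=> b k k'; rewrite scaler_sumr -big_split; apply: eq_bigr => i _ /=.
    by rewrite linearP tpureDl tpureZl.
  exists 1, (mklin lw); split=> [|k]; first exact: S1.
  rewrite scale1r /= !tensor_mapr_pure -/y -[y]scale1r -uv.
  rewrite tpure_sumr; apply: eq_bigr => i _.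
  rewrite -wP tpureZl -tpureZr -linearZ.
  by rewrite /GRing.scale /= mulr1.
have : b * phi x \in p.
  apply/zp; exists (tensor_unit M \o (tensor_mapr M phi \o w)) => k /=.
  by rewrite -wP !linearZ /= tensor_mapr_pure tensor_unit_pure scalerA.
rewrite prime_idealrM (negPf phix) orbF; exact/negP.
Qed.

End NatComplex.

(** * Grades and quasi-projective dimension *)

Section IntegerBounds.
Local Open Scope classical_set_scope.

Lemma supremumE x0 (A : set (\bar int)) x :
  A !=set0 -> supremums A x -> supremum x0 A = x.
Proof.
move=> /set0P/negPf A0 Ax; rewrite /supremum A0.
by apply: (@is_subset1_supremums _ _ A) => //; case: xgetP => // /(_ x).
Qed.

Lemma infimumE x0 (A : set (\bar int)) x :
  A !=set0 -> infimums A x -> infimum x0 A = x.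
Proof.
move=> /set0P/negPf A0 Ax; rewrite /infimum A0.
by apply: (@is_subset1_infimums _ _ A) => //; case: xgetP => // /(_ x).
Qed.

Lemma int_max (A : set int) b : A !=set0 -> (forall i, A i -> i <= b) ->
  exists2 m, A m & forall i, A i -> i <= m.
Proof.
move=> [i0 Ai0] Ab.
have [|n /asboolP An nmin] := @find_ex_minn (fun n => `[< A (b - n%:Z) >]).
  exists `|b - i0|%N; apply/asboolP; have := Ab _ Ai0.
  by move=> le; have -> : b - `|b - i0|%N%:Z = i0 by lia.
exists (b - n%:Z) => // i Ai; have := nmin `|b - i|%N.
have le := Ab _ Ai; have -> : b - `|b - i|%N%:Z = i by lia.
by move=> /(_ (introT (asboolP _) Ai)); lia.
Qed.

Lemma supremum_int (A : set int) : A !=set0 ->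
  (exists m, [/\ A m, forall i, A i -> i <= m &
    supremum -oo%E [set i%:E | i in A] = m%:E]) \/
  ((forall b, exists2 i, A i & b < i) /\
    supremum -oo%E [set i%:E | i in A] = +oo%E).
Proof.
move=> A0; have A0' : [set i%:E | i in A] !=set0.
  by case: A0 => i Ai; exists i%:E; exists i.
have [[b Ab]|nb] := pselect (exists b, forall i, A i -> i <= b).
  left; have [m Am mmax] := int_max A0 Ab; exists m; split=> //.
  apply: supremumE => //; split=> [_ [i Ai <-]|y /(_ m%:E)]; last first.
    by apply; exists m.
  by rewrite lee_fin mmax.
right; have unb b : exists2 i, A i & b < i.
  apply: contrapT => H; apply: nb; exists b => i Ai; rewrite leNgt.
  by apply/negP => bi; apply: H; exists i.
split=> //; apply: supremumE => //; split=> [y _|y Hy]; first exact: leey.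
case: y Hy => [r| |] // Hy.
  have [i Ai ri] := unb r; have := Hy i%:E (ex_intro2 _ _ i Ai erefl).
  by rewrite lee_fin leNgt ri.
by case: A0 => i Ai; have := Hy i%:E (ex_intro2 _ _ i Ai erefl).
Qed.

Lemma infimum_int (A : set int) : A !=set0 ->
  (exists m, [/\ A m, forall i, A i -> m <= i &
    infimum +oo%E [set i%:E | i in A] = m%:E]) \/
  infimum +oo%E [set i%:E | i in A] = -oo%E.
Proof.
move=> A0; have A0' : [set i%:E | i in A] !=set0.
  by case: A0 => i Ai; exists i%:E; exists i.
have [[b Ab]|nb] := pselect (exists b, forall i, A i -> b <= i).
  left; have [||m Am mmax] := @int_max [set - i | i in A] (- b).
  - by case: A0 => i Ai; exists (- i); exists i.
  - by move=> _ [i Ai <-]; rewrite lerN2 Ab.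
  case: Am => m' Am' mE; exists m'.
  have mmin i : A i -> m' <= i.
    by move=> Ai; rewrite -lerN2 mE; apply: mmax; exists i.
  split=> //; apply: infimumE => //; split=> [_ [i Ai <-]|y /(_ m'%:E)]; last first.
    by apply; exists m'.
  by rewrite lee_fin mmin.
right; apply: infimumE => //; split=> [y _|y Hy]; first exact: leNye.
case: y Hy => [r| |] // Hy.
  exfalso; apply: nb; exists r => i Ai.
  by have := Hy i%:E (ex_intro2 _ _ i Ai erefl); rewrite lee_fin.
by case: A0 => i Ai; have := Hy i%:E (ex_intro2 _ _ i Ai erefl).
Qed.

Lemma infimum_nat (A : set (\bar int)) : A !=set0 ->
  (forall x, A x -> exists n : nat, x = n%:Z%:E) ->
  A (infimum +oo%E A) /\ forall x, A x -> (infimum +oo%E A <= x)%E.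
Proof.
move=> A0 An.
have [|n /asboolP AnE nmin] := @find_ex_minn (fun n => `[< A n%:Z%:E >]).
  case: A0 => x Ax; have [n xE] := An x Ax.
  by exists n; apply/asboolP; rewrite -xE.
have nlb x : A x -> (n%:Z%:E <= x)%E.
  move=> Ax; have [m xE] := An x Ax; rewrite xE lee_fin lez_nat nmin //.
  by apply/asboolP; rewrite -xE.
have -> : infimum +oo%E A = n%:Z%:E; last by [].
by apply: infimumE => //; split=> [|y Hy]; [exact: nlb|exact: Hy].
Qed.

End IntegerBounds.

Section Grade.
Variable R : comNzRingType.
Implicit Types A B C L M N U V : lmodType R.

Lemma gradeP L V :
  (grade L V = +oo%E /\ forall n, Evan (eq 1) (sres_d L) n V) \/
  exists n, [/\ grade L V = n%:Z%:E, nonzero_module (Ext n L V) &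
    Evan (eq 1) (sres_d L) n V].
Proof.
rewrite /grade; set A := (X in infimum _ X).
have [A0|/set0P/negP/negPn/eqP A0] := pselect (A !=set0)%classic; last first.
  left; rewrite A0 /infimum eqxx; split=> // n i _; apply/Ext_vanish => Ei.
  have : A i%:Z%:E by exists i.
  by rewrite A0.
have [|[n En nE] nlb] := infimum_nat A0; first by move=> _ [n _ <-]; exists n.
right; exists n; split=> // i; rewrite ltnNge => lt; apply/Ext_vanish => Ei.
have := nlb i%:Z%:E; rewrite -nE lee_fin lez_nat (negPf lt).
by move=> H; have := H (ex_intro2 _ _ i Ei erefl).
Qed.

Lemma qTor_acyclic M N : qTor M N = 0%E -> Tor_acyclic M N.
Proof.
move=> q0; apply: Tor_acyclicP => i Ti.
pose B := [set j%:Z | j in [set j | nonzero_module (Tor j M N)]]%classic.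
have B0 : (B !=set0)%classic by exists i.+1%:Z, i.+1.
have qE : qTor M N = supremum -oo%E [set j%:E | j in B]%classic.
  by rewrite /qTor /B image_comp.
have [[m [_ mmax mE]]|[_ mE]] := supremum_int B0;
  move: q0; rewrite qE mE // => -[m0].
by have := mmax i.+1%:Z (ex_intro2 _ _ i.+1 Ti erefl); rewrite m0.
Qed.

Lemma isomorphic_nonzero U V :
  isomorphic U V -> nonzero_module V -> nonzero_module U.
Proof.
move=> [f [g fg gf]] [v v0]; exists (g v); apply: contra_neq v0 => gv.
by rewrite -[v]gf gv linear0.
Qed.

Lemma homology_nonzero A B C (f : {linear A -> B}) (g : {linear B -> C}) :
  nonzero_module (homology f g) -> nonzero_module B.
Proof.
move=> [h h0]; apply: contrapT => B0; move/negP: h0; apply; apply/eqP.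
have [z <-] := @qpi_surj _ _ _ h; have -> : z = 0; last exact: linear0.
apply: (@kinc_inj _ _ _ g); rewrite linear0; apply: contrapT => z0.
by apply: B0; exists (kinc g z); exact/eqP.
Qed.

Lemma trivial_module V : ~ nonzero_module V <-> forall x : V, x = 0.
Proof.
split=> [H x|H [x]]; last by rewrite (H x) eqxx.
by apply: contrapT => x0; apply: H; exists x; exact/eqP.
Qed.

End Grade.

Section QuasiProjective.
Variables (R : comNzRingType) (N : lmodType R) (P : complex R).
Hypothesis nzN : nonzero_module N.
Hypotheses (qP : quasi_proj_resolution N P) (bP : bounded P).

Lemma qpr_bounds : exists (b s t : int) (a : int -> nat),
  [/\ (forall i, i < b -> forall x : P i, x = 0) /\
        (forall i, t < i -> forall x : P i, x = 0),
      csup P = t%:E /\ chsup P = s%:E, b <= s <= t, (0 < a s)%N /\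
        (forall i, s < i -> forall x : cplx_homology P i, x = 0) &
      forall i, b <= i -> isomorphic (cplx_homology P i) {ffun 'I_(a i) -> N}].
Proof.
have [bb _ [a [[i0 bi0 ai0] aH]]] := qP.
have nzH i : (cinf P <= i%:E)%E -> (0 < a i)%N ->
    nonzero_module (cplx_homology P i).
  move=> /aH/isomorphic_nonzero H a0; apply: H; case: (a i) a0 => // k _.
  have [n n0] := nzN; exists [ffun=> n]; apply: contra_neq n0.
  by move=> /(congr1 (fun h : {ffun _ -> _} => h ord0)); rewrite !ffunE.
have H0 : [set i | nonzero_module (cplx_homology P i)]%classic i0.
  by apply: nzH => //; rewrite lt0n.
have P0 : [set i | nonzero_module (P i)]%classic i0 := homology_nonzero H0.
have [[b [_ bmin bE]]|bE] := infimum_int (ex_intro _ i0 P0); last first.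
  by move: bb; rewrite /bounded_below /cinf bE.
have {}bE : cinf P = b%:E := bE.
have [[t [_ tmax tE]]|[_ tE]] := supremum_int (ex_intro _ i0 P0); last first.
  by move: bP; rewrite /bounded /csup tE bE.
have [[s [Hs smax sE]]|[Hub _]] := supremum_int (ex_intro _ i0 H0); last first.
  have [i /homology_nonzero Pi] := Hub t; by have := tmax i Pi; lia.
have Ps := homology_nonzero Hs.
exists b, s, t, a; split=> //.
- split=> i ib; apply/trivial_module => /[dup] Pi; last by move/tmax; lia.
  by move/bmin; lia.
- by rewrite bmin // tmax.
- split; last by move=> i si; apply/trivial_module => /smax; lia.
  rewrite lt0n; apply: contraPN Hs => /eqP as0.
  have /aH[f fb] : (cinf P <= s%:E)%E by rewrite bE lee_fin bmin.
  apply/trivial_module => x; apply: (bij_inj fb).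
  by apply/ffunP => -[k kl]; exfalso; rewrite as0 in kl.
- by move=> i bi; apply: aH; rewrite bE lee_fin.
Qed.

End QuasiProjective.

Section ComplexIndex.
Variables (R : comNzRingType) (P : complex R).

Lemma cplx_d_target i j j' x : j = j' ->
  cplx_d P i j x = 0 <-> cplx_d P i j' x = 0.
Proof. by move=> <-. Qed.

Lemma cplx_d_source i i' j y : i = i' ->
  (exists x, cplx_d P i j x = y) <-> exists x, cplx_d P i' j x = y.
Proof. by move=> <-. Qed.

End ComplexIndex.

Section QuasiProjectiveGrade.
Variables (R : comNzRingType) (M N : lmodType R) (P : complex R).
Hypothesis nzN : nonzero_module N.
Hypotheses (qP : quasi_proj_resolution N P) (bP : bounded P).
Hypothesis TN : Tor_acyclic M N.

Lemma qpr_grade : exists k : nat,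
  [/\ (csup P - chsup P = k%:Z%:E)%E,
      forall L g h, Evan (eq 1) (sres_d L) g M ->
        Evan (eq 1) (sres_d L) h (tensor M N) -> (h + k < g)%N ->
        Enull (eq 1) (sres_d L) h (tensor M N) &
      forall L g h n, noetherian_ring R -> fin_gen L -> supp_sub L N ->
        Evan (eq 1) (sres_d L) g M -> nonzero_module (Ext g L M) ->
        Evan (eq 1) (sres_d L) h (tensor M N) ->
        Evan (eq 1) (sres_d N) n R^o -> (h + n <= g)%N].
Proof.
have [b [s [t [a [[Pb Pt] [tE sE] /andP[bs st] [as0 Hs] aH]]]]] :=
  qpr_bounds nzN qP bP.
(* the shift makes [D 0 = 0] *)
pose c := b - 1.
pose D (j : nat) := P (c + j%:Z); pose E (j : nat) := P (c + j%:Z - 1).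
pose a' (j : nat) := if j is 0 then 0%N else a (c + j%:Z).
pose H (j : nat) : lmodType R := {ffun 'I_(a' j) -> N}.
pose d j : {linear D j.+1 -> D j} := cplx_d P (c + j.+1%:Z) (c + j%:Z).
pose e j : {linear D j -> E j} := cplx_d P (c + j%:Z) (c + j%:Z - 1).
have ker_e j x : e j.+1 x = 0 <-> d j x = 0.
  by apply: cplx_d_target; lia.
have ed j x : e j (d j x) = 0 by exact: cplx_dd.
have D0 (x : D 0) : x = 0 by apply: Pb; rewrite /c; lia.
have hpE j : exists f : {linear ker (e j) -> H j}, surj f /\
    forall z, f z = 0 <-> exists x, d j x = kinc (e j) z.
  case: j => [|j].
    exists \0; split=> [y|z]; first by exists 0; apply/ffunP => -[].
    split=> // _; exists 0; rewrite linear0.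
    exact: (esym (D0 (kinc (e 0) z))).
  have [f fb] : isomorphic (cplx_homology P (c + j.+1%:Z)) (H j.+1).
    by apply: aH; rewrite /c; lia.
  exists (f \o qpi _); split=> [y|z].
    have [g _ gf] := fb; have [z zP] := @qpi_surj _ _ _ (g y).
    by exists z; rewrite /= zP gf.
  have -> : (f \o qpi _) z = 0 <-> exists x,
      cplx_d P (c + j.+1%:Z + 1) (c + j.+1%:Z) x = val z.
    set S := bnd_pred (cplx_d P (c + j.+1%:Z + 1) (c + j.+1%:Z)) (g := e j.+1).
    split=> [fz|xz].
      suff /qpi0/asboolP : qpi S z = 0 by [].
      by apply: (bij_inj fb); rewrite linear0.
    rewrite /=; have -> : qpi S z = 0 by apply/qpi0/asboolP.
    exact: linear0.
  by apply: cplx_d_source; lia.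
pose hp j := projT1 (cid (hpE j)).
have hp_surj j : surj (hp j) := (projT2 (cid (hpE j))).1.
have hp_ker j := (projT2 (cid (hpE j))).2.
pose s' := `|s - c|%N; pose t' := `|t - c|%N.
have s'E : c + s'%:Z = s by rewrite /s' /c; lia.
have t'E : c + t'%:Z = t by rewrite /t' /c; lia.
have DR j : ssum (eq 1) (D j) R^o.
  by have [_ /(_ (c + j%:Z))[fP pP] _] := qP; exact: fin_gen_projective_ssum.
have HN j : ssum (eq 1) (H j) N by exact: ffun_ssum.
have s0 : (0 < s')%N by rewrite /s' /c; lia.
have NH : ssum (eq 1) N (H s').
  by apply: ssum_ffun; move: s0 s'E; case: (s') => // k _ kE; rewrite /a' kE.
have Hs' j : (s' < j)%N -> forall x : H j, x = 0.
  move=> sj x; have [z <-] := hp_surj j x; apply/hp_ker.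
  have := Hs (c + j%:Z); move/(_ ltac:(lia)) => H0.
  have /qpi0/asboolP := H0 (qpi _ z).
  by move/(cplx_d_source _ (i' := c + j.+1%:Z)); apply; lia.
have Dt j : (t' < j)%N -> forall x : D j, x = 0 by move=> tj; apply: Pt; lia.
have st' : (s' <= t')%N by lia.
exists (t' - s')%N; split.
- by rewrite tE sE -EFinB; congr (_%:E); lia.
- move=> L g h gM hMN hg.
  by apply: (grade_tensor_ub ker_e ed D0 hp_surj hp_ker DR HN NH Hs' Dt st' s0
    TN gM hMN hg).
- move=> L g h n noeth fgL LN gM Eg hMN nN.
  by apply: (grade_tensor_lb ker_e ed D0 hp_surj hp_ker DR HN NH Hs' Dt st' s0
    TN noeth fgL LN gM Eg hMN nN).
Qed.

End QuasiProjectiveGrade.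

Theorem theorem6p6 (R : comNzRingType)
  (noethR : noetherian_ring R) (localR : local_ring R)
  (M N : lmodType R)
  (fgM : fin_gen M) (fgN : fin_gen N)
  (nzM : nonzero_module M) (nzN : nonzero_module N)
  (qpdN : (qpd N < +oo)%E) (qMN : qTor M N = 0%E)
  (L : lmodType R) (fgL : fin_gen L) :
  [/\ (grade L M <= grade L (tensor M N) + qpd N)%E,
      supp_sub L N ->
        (grade L (tensor M N) + grade1 N <= grade L M)%E
    & supp_sub L N -> quasi_perfect N ->
        grade L M = (grade L (tensor M N) + qpd N)%E /\
        (grade L (tensor M N) + grade1 N)%E = grade L M].
Proof.
have TN := qTor_acyclic qMN.
have [k [kE ub lb]] : exists k : nat, [/\ qpd N = k%:Z%:E,
    forall g h, Evan (eq 1) (sres_d L) g M ->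
      Evan (eq 1) (sres_d L) h (tensor M N) -> (h + k < g)%N ->
      Enull (eq 1) (sres_d L) h (tensor M N) &
    forall g h n, supp_sub L N ->
      Evan (eq 1) (sres_d L) g M -> nonzero_module (Ext g L M) ->
      Evan (eq 1) (sres_d L) h (tensor M N) ->
      Evan (eq 1) (sres_d N) n R^o -> (h + n <= g)%N].
  move: qpdN; rewrite /qpd; set A := (X in infimum _ X) => AN.
  have [A0|/set0P/negP/negPn/eqP A0] := pselect (A !=set0)%classic; last first.
    by move: AN; rewrite A0 /infimum eqxx.
  have [|[P [qP bP ->]] _] := infimum_nat A0.
    move=> _ [P [qP bP ->]].
    by have [k [kE _ _]] := qpr_grade nzN qP bP TN; exists k.
  have [k [kE ub lb]] := qpr_grade nzN qP bP TN.
  exists k; split=> //; first exact: ub.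
  by move=> g h n; exact: lb.
have leq1 : (grade L M <= grade L (tensor M N) + qpd N)%E.
  rewrite kE; have [[-> _]|[h [-> Eh hMN]]] := gradeP L (tensor M N).
    by rewrite addye // leey.
  have low g : Evan (eq 1) (sres_d L) g M -> (g <= h + k)%N.
    move=> gM; rewrite leqNgt; apply/negP => hg; apply/Ext_vanish: Eh.
    exact: ub gM hMN hg.
  have [[_ gM]|[g [-> _ gM]]] := gradeP L M.
    by have := low _ (gM (h + k).+1); rewrite ltnn.
  by rewrite -EFinD lee_fin -PoszD lez_nat low.
have leq2 : supp_sub L N -> (grade L (tensor M N) + grade1 N <= grade L M)%E.
  move=> LN; have [[-> _]|[g [-> Eg gM]]] := gradeP L M; first exact: leey.
  have {lb}lb h n := lb g h n LN gM Eg.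
  have [[_ hMN]|[h [-> _ hMN]]] := gradeP L (tensor M N).
    by have := lb g.+1 0%N (hMN _) (fun i H => False_ind _ (notF H)); lia.
  rewrite /grade1; have [[_ nN]|[n [-> _ nN]]] := gradeP N R^o.
    by have := lb h g.+1 hMN (nN _); lia.
  by rewrite -EFinD lee_fin -PoszD lez_nat lb.
split=> // LN [_ qE]; have := leq2 LN; rewrite -qE => leq2'.
by split; apply/le_anti; rewrite ?leq1 ?leq2'.
Qed.
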